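(* Let $(X_1,Y_1),\ldots,(X_n,Y_n)$, $n\ge 2$, be i.i.d. copies of a random pair $(X,Y)$ with distribution $P$ on $\mathcal{X}\times\mathbb{R}$, where $Y$ is square integrable. Let $\varphi_1,\ldots,\varphi_d:\mathcal{X}\to\mathbb{R}$ be square integrable functions (with respect to the law of $X$), $\varphi(x)=(\varphi_1(x),\ldots,\varphi_d(x))^T$, and for $\theta\in\mathbb{R}^d$ let $f_\theta(x)=\langle\theta,\varphi(x)\rangle$. Let $\Theta\subseteq\mathbb{R}^d$ be a closed convex set (possibly $\Theta=\mathbb{R}^d$) and $\lambda\ge 0$. Let $R(f)=\mathbb{E}\{[Y-f(X)]^2\}$, $r(f)=\frac1n\sum_{i=1}^n[f(X_i)-Y_i]^2$, let $\hat\theta^{(\mathrm{ridge})}\in\arg\min_{\theta\in\Theta}\{r(f_\theta)+\lambda\|\theta\|^2\}$ and $\hat f^{(\mathrm{ridge})}=f_{\hat\theta^{(\mathrm{ridge})}}$, and let $\tilde\theta\in\arg\min_{\theta\in\Theta}\{R(f_\theta)+\lambda\|\theta\|^2\}$ and $\tilde f=f_{\tilde\theta}$. Assume $$\mathbb{E}[\|\varphi(X)\|^4]<+\infty\quad\text{and}\quad\mathbb{E}\{\|\varphi(X)\|^2[\tilde f(X)-Y]^2\}<+\infty.$$ Let $Q=\mathbb{E}[\varphi(X)\varphi(X)^T]$ with eigenvalues $\nu_1\ge\cdots\ge\nu_d$, let $Q_\lambda=Q+\lambda I$, and define the effective ridge dimension $$D=\sum_{i=1}^d\frac{\nu_i}{\nu_i+\lambda}\mathbb{1}(\nu_i>0)=\mathbb{E}[\|Q_\lambda^{-1/2}\varphi(X)\|^2].$$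 Then for any $\varepsilon>0$ there exists $n_\varepsilon$ such that for any $n\ge n_\varepsilon$, with probability at least $1-\varepsilon$, $$R(\hat f^{(\mathrm{ridge})})+\lambda\|\hat\theta^{(\mathrm{ridge})}\|^2\le\min_{\theta\in\Theta}\{R(f_\theta)+\lambda\|\theta\|^2\}+\frac{30\,\mathbb{E}\{\|Q_\lambda^{-1/2}\varphi(X)\|^2[\tilde f(X)-Y]^2\}}{\mathbb{E}\{\|Q_\lambda^{-1/2}\varphi(X)\|^2\}}\frac{D}{n}+1000\sup_{v\in\mathbb{R}^d}\frac{\mathbb{E}[\langle v,\varphi(X)\rangle^2[\tilde f(X)-Y]^2]}{\mathbb{E}(\langle v,\varphi(X)\rangle^2)+\lambda\|v\|^2}\frac{\log(3\varepsilon^{-1})}{n}$$ $$\le\min_{\theta\in\Theta}\{R(f_\theta)+\lambda\|\theta\|^2\}+\operatorname{ess\,sup}\mathbb{E}\{[Y-\tilde f(X)]^2\mid X\}\,\frac{30D+1000\log(3\varepsilon^{-1})}{n}.$$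
   Context: $\|\cdot\|$ and $\langle\cdot,\cdot\rangle$ denote the Euclidean norm and inner product on $\mathbb{R}^d$; $I$ is the $d\times d$ identity matrix. When $\lambda=0$, $D$ equals the rank of $Q$. *)

(* Defs.v *)
From HB Require Import structures.
From mathcomp Require Import all_boot all_order all_algebra.
From mathcomp Require Import all_classical all_reals all_analysis.
From mathcomp Require Import measurable_realfun.
Set Implicit Arguments. Unset Strict Implicit. Unset Printing Implicit Defensive.
Import Order.TTheory GRing.Theory Num.Def Num.Theory.
Import numFieldNormedType.Exports.
Local Open Scope classical_set_scope.
Local Open Scope ring_scope.

Definition dotv (R : realType) (d : nat) (u v : 'rV[R]_d) : R :=
  \sum_(i < d) u 0 i * v 0 i.
Definition sqnorm (R : realType) (d : nat) (u : 'rV[R]_d) : R := dotv u u.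

(* expectation (real-valued; used only for integrable quantities) *)
Definition expect (R : realType) (dT : measure_display) (T : measurableType dT)
  (mu : {measure set T -> \bar R}) (h : T -> R) : R :=
  fine (\int[mu]_z (h z)%:E).

Definition f_lin (R : realType) (d : nat) (dX : measure_display)
  (X : measurableType dX) (phi : X -> 'rV[R]_d) (theta : 'rV[R]_d) (x : X) : R :=
  dotv theta (phi x).

Definition pop_obj (R : realType) (d : nat) (dX : measure_display)
  (X : measurableType dX) (P : probability (X * R)%type R)
  (phi : X -> 'rV[R]_d) (lam : R) (theta : 'rV[R]_d) : R :=
  expect P (fun z => (z.2 - f_lin phi theta z.1) ^+ 2) + lam * sqnorm theta.

Definition emp_obj (R : realType) (d : nat) (dX : measure_display)
  (X : measurableType dX) (n : nat) (s : 'I_n -> (X * R)%type)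
  (phi : X -> 'rV[R]_d) (lam : R) (theta : 'rV[R]_d) : R :=
  n%:R^-1 * (\sum_(i < n) (f_lin phi theta (s i).1 - (s i).2) ^+ 2)
  + lam * sqnorm theta.

Definition Qmat (R : realType) (d : nat) (dX : measure_display)
  (X : measurableType dX) (P : probability (X * R)%type R)
  (phi : X -> 'rV[R]_d) : 'M[R]_d :=
  \matrix_(i, j) expect P (fun z => phi z.1 0 i * phi z.1 0 j).

Definition spectral_decomp (R : realType) (d : nat) (Q U : 'M[R]_d)
  (nu : 'rV[R]_d) : Prop :=
  U *m U^T = 1%:M /\ Q = U^T *m diag_mx nu *m U /\
  (forall i j : 'I_d, (i <= j)%N -> nu 0 j <= nu 0 i).

(* Q_lambda^{-1/2} = U^T diag((nu_i + lambda)^{-1/2}) U, where (as usual for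
   the pseudo-inverse, and by MathComp's convention 0^-1 = 0) zero
   eigenvalues of Q_lambda are sent to 0. *)
Definition Qlam_isqrt (R : realType) (d : nat) (U : 'M[R]_d) (nu : 'rV[R]_d)
  (lam : R) : 'M[R]_d :=
  U^T *m diag_mx (\row_i (Num.sqrt (nu 0 i + lam))^-1) *m U.

Definition ridge_dim (R : realType) (d : nat) (nu : 'rV[R]_d) (lam : R) : R :=
  \sum_(i < d) (if 0 < nu 0 i then nu 0 i / (nu 0 i + lam) else 0).

(* (Z_1,...,Z_n) are i.i.d. with law P on the probability space (O, Pr):
   each Z_i is measurable with distribution P, and they are mutually
   independent (product rule for every family of measurable sets; taking
   A_i = setT recovers the product rule for every subfamily). *)
Definition iid_sample (R : realType) (dX : measure_display)
  (X : measurableType dX) (P : probability X R)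
  (dO : measure_display) (O : measurableType dO) (Pr : probability O R)
  (n : nat) (Z : 'I_n -> O -> X) : Prop :=
  (forall i, measurable_fun setT (Z i)) /\
  (forall i A, measurable A -> Pr (Z i @^-1` A) = P A) /\
  (forall A : 'I_n -> set X, (forall i, measurable (A i)) ->
     fine (Pr (\bigcap_(i in [set: 'I_n]) (Z i @^-1` A i)))
     = \prod_(i < n) fine (Pr (Z i @^-1` A i))).

Definition cond_exp_X (R : realType) (dX : measure_display)
  (X : measurableType dX) (P : probability (X * R)%type R)
  (h : (X * R)%type -> R) (g : X -> \bar R) : Prop :=
  measurable_fun setT g /\
  forall A : set X, measurable A ->
    (\int[P]_(z in A `*` [set: R]) g z.1 = \int[P]_(z in A `*` [set: R]) (h z)%:E)%E.

(* Main.v *)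
Require Import Defs.
From HB Require Import structures.
From mathcomp Require Import all_boot all_order all_algebra.
From mathcomp Require Import all_classical all_reals all_analysis.
From mathcomp Require Import measurable_realfun ess_sup_inf ring lra.
Import Order.TTheory GRing.Theory Num.Def Num.Theory.
Import numFieldNormedType.Exports.
Local Open Scope classical_set_scope.
Local Open Scope ring_scope.
Set Implicit Arguments. Unset Strict Implicit. Unset Printing Implicit Defensive.

#[local] Hint Extern 0 (is_true (1 <= 2%:E)%E) => exact: lee1n : core.

(* Put xi = f_theta~(X) - Y, psi = Q_lambda^(-1/2) phi(X) and zeta = xi psi, and let Z be
   the deviation of the empirical mean of the zeta_i from E zeta. As the empirical objective
   is quadratic along the segment from theta~ to its minimiser, the excess ridge risk is at
   most 2 |Z|^2 as soon as the empirical covariance of psi is within 1/4 of its expectation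
   in Frobenius norm, which a weak law of large numbers ensures. So everything rests on a
   deviation bound for Z that separates the trace E|zeta|^2 from S = sup_t q(t) / |t|^2,
   where q(t) = E <t, zeta>^2.
   Only second moments are available, so exp <t, sqrt n Z> is replaced by a product of
   factors 1 + y_i + y_i^2 with y_i = <t, zeta_i> / sqrt n: it dominates the exponential
   unless some |zeta_i| is of order sqrt n, an event of vanishing probability, and its mean
   is at most exp (q(t)) up to centring. Averaging over t a sum of many small random signs
   along the axes, the entropy lower bound for exponential averages (tilt the signs so that
   t has mean x / (4 S)) gives
     E_t exp (<t, x> - q(t)) >= exp ((|x|^2 / 16 - E|zeta|^2 / 2) / S),
   and Markov's inequality yields n |Z|^2 <= 8 E|zeta|^2 + 16 S log (2 / eps). *)

Section elementary_inequalities.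
Context {R : realType}.
Implicit Types a b c y eps : R.

Lemma expR_le_quadratic y : y <= 3^-1 -> expR y <= 1 + y + y ^+ 2.
Proof.
move=> y_le; have y_lt2 : 0 < 1 - y / 2 by lra.
have expRN_ge : (1 - y / 2) ^+ 2 <= (expR y)^-1.
  rewrite -expRN [- y](_ : _ = 2%:R * (- y / 2)); last by field.
  rewrite expRM_natl ler_pXn2r ?nnegrE ?(ltW y_lt2) ?expR_ge0//.
  by have := expR_ge1Dx (- y / 2); rewrite mulNr.
have quad_ge0 : 0 <= 1 + y + y ^+ 2 by nra.
have : 1 <= (1 + y + y ^+ 2) * (1 - y / 2) ^+ 2.
  have -> : (1 + y + y ^+ 2) * (1 - y / 2) ^+ 2 =
    1 + y ^+ 2 / 4 * ((1 - 3 * y) + y ^+ 2) by field.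
  rewrite lerDl mulr_ge0 ?divr_ge0 ?sqr_ge0// addr_ge0 ?sqr_ge0//; lra.
move=> /le_trans/(_ (ler_wpM2l quad_ge0 expRN_ge)).
by rewrite ler_pdivlMr ?expR_gt0// mul1r.
Qed.

(* The variational formula for [ln ((expR a + expR b) / 2)] at the law on two
   points with mean [y], whose entropy relative to the fair one is at most [y ^+ 2]. *)
Lemma expR_tilted_mean_le y a b : `|y| < 1 ->
  expR ((1 + y) / 2 * a + (1 - y) / 2 * b - y ^+ 2) <= (expR a + expR b) / 2.
Proof.
rewrite ltr_norml => /andP[y_gtN1 y_lt1].
have p_ge0 : 0 <= (1 + y) / 2 by lra.
have p_le1 : (1 + y) / 2 <= 1 by lra.
set a' := a - ln (1 + y); set b' := b - ln (1 - y).
have jensen : expR ((1 + y) / 2 * a' + (1 - y) / 2 * b') <=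
    (1 + y) / 2 * expR a' + (1 - y) / 2 * expR b'.
  rewrite [(1 - y) / 2](_ : _ = 1 - (1 + y) / 2); last by field.
  exact: (convex_expR (Itv01 p_ge0 p_le1) a' b').
have -> : (expR a + expR b) / 2 = (1 + y) / 2 * expR a' + (1 - y) / 2 * expR b'.
  rewrite /a' /b' !expRB !lnK ?posrE; [|lra|lra].
  by field; apply/andP; split; rewrite gt_eqF//; lra.
apply: le_trans jensen; rewrite ler_expR.
have lnD : (1 + y) / 2 * ln (1 + y) <= (1 + y) / 2 * y by rewrite ler_wpM2l// le_ln1Dx.
have lnB : (1 - y) / 2 * ln (1 - y) <= (1 - y) / 2 * - y.
  by rewrite ler_wpM2l ?le_ln1Dx//; lra.
rewrite /a' /b'; lra.
Qed.

Lemma quadratic_min_slope_le0 b a : 0 <= a ->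
  (forall t, 0 < t < 1 -> b + a <= b * t + a * t ^+ 2) -> b + 2 * a <= 0.
Proof.
move=> a_ge0 min1; rewrite leNgt; apply/negP => slope_gt0.
set e := b + 2 * a in slope_gt0; have ea_gt0 : 0 < e + a by lra.
pose t := 1 - e / (2 * (e + a)).
have tE : (1 - t) * (e + a) = e / 2 by rewrite /t; field; rewrite gt_eqF.
have t_lt1 : 0 < 1 - t by rewrite /t subKr divr_gt0// mulr_gt0.
have t_gt0 : 0 < t by nra.
have curvature_small : a * (1 - t) <= e / 2 by nra.
have : 0 < (1 - t) * (e - a * (1 - t)) by rewrite mulr_gt0//; lra.
by have := min1 t; rewrite t_gt0 -subr_gt0 t_lt1 /e => /(_ isT); lra.
Qed.

Lemma ge0_ler_pdivrMr a b c : 0 <= b -> 0 <= c -> a <= c * b -> a / b <= c.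
Proof.
rewrite le_eqVlt => /predU1P[<- c_ge0 _|b_gt0 _]; first by rewrite invr0 mulr0.
by rewrite ler_pdivrMr.
Qed.

Lemma ln_confidence_le eps : 0 < eps <= 1 -> ln (2 / (eps / 2)) <= 2 * ln (3 * eps^-1).
Proof.
move=> /andP[eps_gt0 eps_le1]; have eV_ge1 : 1 <= eps^-1 by rewrite invf_ge1.
rewrite [leRHS]mulr_natl -lnXn ?mulr_gt0 ?invr_gt0//.
rewrite ler_ln ?posrE ?exprn_gt0 ?divr_gt0 ?mulr_gt0 ?invr_gt0//.
have -> : 2 / (eps / 2) = 4 * eps^-1 by field; rewrite gt_eqF.
nra.
Qed.

End elementary_inequalities.

Lemma inf_image_min (R : realType) (T : Type) (D : set T) (f : T -> R) x0 :
  D x0 -> (forall x, D x -> f x0 <= f x) -> inf [set f x | x in D] = f x0.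
Proof.
move=> Dx0 f_min; apply/eqP; rewrite eq_le; apply/andP; split.
  by apply: ge_inf; [exists (f x0) => _ [x Dx <-]; exact: f_min|exists x0].
by apply: lb_le_inf => [|_ [x Dx <-]]; [exists (f x0), x0|exact: f_min].
Qed.

(** * Linear algebra *)

Section dot_product.
Context {R : realType} {d : nat}.
Implicit Types u v w x : 'rV[R]_d.

Lemma dotvE u v : dotv u v = (u *m v^T) 0 0.
Proof. by rewrite mxE; apply: eq_bigr => i _; rewrite mxE. Qed.

Lemma dotvC u v : dotv u v = dotv v u.
Proof. by apply: eq_bigr => i _; rewrite mulrC. Qed.

Lemma dotvDl u v w : dotv (u + v) w = dotv u w + dotv v w.
Proof. by rewrite !dotvE mulmxDl mxE. Qed.

Lemma dotvZl c u w : dotv (c *: u) w = c * dotv u w.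
Proof. by rewrite !dotvE -scalemxAl mxE. Qed.

Lemma dot0v w : dotv 0 w = 0.
Proof. by rewrite dotvE mul0mx mxE. Qed.

Lemma dotvDr u v w : dotv w (u + v) = dotv w u + dotv w v.
Proof. by rewrite dotvC dotvDl !(dotvC w). Qed.

Lemma dotvZr c u w : dotv w (c *: u) = c * dotv w u.
Proof. by rewrite dotvC dotvZl dotvC. Qed.

Lemma dotvBr u v w : dotv w (u - v) = dotv w u - dotv w v.
Proof. by rewrite -scaleN1r dotvDr dotvZr mulN1r. Qed.

Lemma dotv_sumr I (r : seq I) (F : I -> 'rV[R]_d) w :
  dotv w (\sum_(i <- r) F i) = \sum_(i <- r) dotv w (F i).
Proof.
elim: r => [|i r ih]; first by rewrite !big_nil dotvC dot0v.
by rewrite !big_cons dotvDr ih.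
Qed.

Lemma dotv_deltal k w : dotv (delta_mx 0 k) w = w 0 k.
Proof. by rewrite dotvE -rowE !mxE. Qed.

Lemma sqnormE u : sqnorm u = \sum_i u 0 i ^+ 2.
Proof. by apply: eq_bigr => i _; rewrite expr2. Qed.

Lemma sqnorm_ge0 u : 0 <= sqnorm u.
Proof. by rewrite sqnormE sumr_ge0// => i _; exact: sqr_ge0. Qed.

Lemma sqnorm_eq0 u : (sqnorm u == 0) = (u == 0).
Proof.
apply/eqP/eqP => [|->]; last by rewrite /sqnorm dot0v.
rewrite sqnormE => /psumr_eq0P u_eq0; apply/rowP => i; rewrite mxE.
by apply/eqP; rewrite -sqrf_eq0 u_eq0// => j _; exact: sqr_ge0.
Qed.

Lemma sqnormZ c u : sqnorm (c *: u) = c ^+ 2 * sqnorm u.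
Proof. by rewrite /sqnorm dotvZl dotvZr mulrA. Qed.

Lemma sqnormD u v : sqnorm (u + v) = sqnorm u + 2 * dotv u v + sqnorm v.
Proof. by rewrite /sqnorm dotvDl !dotvDr (dotvC v u); ring. Qed.

Lemma sqr_coord_le u k : u 0 k ^+ 2 <= sqnorm u.
Proof.
by rewrite sqnormE (bigD1 k)//= lerDl sumr_ge0// => i _; exact: sqr_ge0.
Qed.

Lemma sqr_dotv_le u v : dotv u v ^+ 2 <= sqnorm u * sqnorm v.
Proof.
have [->|v_neq0] := eqVneq v 0; first by rewrite dotvC dot0v expr0n mulr_ge0// sqnorm_ge0.
have v_gt0 : 0 < sqnorm v by rewrite lt_neqAle sqnorm_ge0 eq_sym sqnorm_eq0 v_neq0.
have := sqnorm_ge0 (sqnorm v *: u + (- dotv u v) *: v).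
rewrite sqnormD !sqnormZ dotvZl dotvZr.
have -> : sqnorm v ^+ 2 * sqnorm u + 2 * (sqnorm v * (- dotv u v * dotv u v)) +
    (- dotv u v) ^+ 2 * sqnorm v = sqnorm v * (sqnorm u * sqnorm v - dotv u v ^+ 2).
  by ring.
by rewrite pmulr_rge0// subr_ge0.
Qed.

Lemma exists_shrink x (r : R) : 0 <= r <= sqnorm x ->
  exists2 x', sqnorm x' = r & r <= dotv x' x.
Proof.
move=> /andP[r_ge0 r_le]; have [x_eq0|x_neq0] := eqVneq (sqnorm x) 0.
  by exists x; rewrite -/(sqnorm x) ?x_eq0; lra.
have x_gt0 : 0 < sqnorm x by rewrite lt_neqAle eq_sym x_neq0 sqnorm_ge0.
pose c := Num.sqrt (r / sqnorm x).
have c_sqr : c ^+ 2 * sqnorm x = r by rewrite sqr_sqrtr ?divr_ge0 ?sqnorm_ge0// divfK.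
exists (c *: x); rewrite ?sqnormZ// dotvZl -c_sqr ler_wpM2r ?sqnorm_ge0//.
by rewrite expr2 ler_piMl ?sqrtr_ge0// -sqrtr1 ler_wsqrtr// ler_pdivrMr// mul1r.
Qed.

End dot_product.

Section outer_square.
Context {R : realType} {d : nat}.
Implicit Types u v : 'rV[R]_d.

Lemma dotv_mulmxr e (M : 'M[R]_(e, d)) u (v : 'rV[R]_e) :
  dotv u (v *m M) = dotv (u *m M^T) v.
Proof. by rewrite !dotvE trmx_mul mulmxA. Qed.

Lemma dotv_row m e (A : 'M[R]_(m, d)) (B : 'M[R]_(e, d)) i j :
  dotv (row i A) (row j B) = (A *m B^T) i j.
Proof. by rewrite mxE; apply: eq_bigr => k _; rewrite !mxE. Qed.

Definition outer_sqr u : 'rV[R]_(d * d) := mxvec (u^T *m u).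

Lemma dotv_outer_sqr u v : dotv (outer_sqr u) (outer_sqr v) = dotv u v ^+ 2.
Proof.
rewrite [LHS]dotvE /outer_sqr mxvec_dotmul mulmxA -mulmxA mxE big_ord1.
by rewrite -!dotvE (dotvC v) expr2.
Qed.

Lemma sqnorm_outer_sqr u : sqnorm (outer_sqr u) = sqnorm u ^+ 2.
Proof. by rewrite /sqnorm dotv_outer_sqr. Qed.

End outer_square.

Lemma outer_sqr_mulmx (R : realType) (d e : nat) (M : 'M[R]_(d, e)) (v : 'rV[R]_d) :
  outer_sqr (v *m M) = outer_sqr v *m (lin_mulmx M^T *m lin_mulmxr M).
Proof. by rewrite mulmxA !mul_vec_lin /= /outer_sqr trmx_mul !mulmxA. Qed.

Section spectral_calculus.
Context {R : realType} {d : nat}.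
Variables (U : 'M[R]_d) (nu : 'rV[R]_d).
Hypothesis UU : U *m U^T = 1%:M.
Implicit Types (f g : R -> R) (u : 'rV[R]_d).

Definition spectral_fun f : 'M[R]_d := U^T *m diag_mx (\row_k f (nu 0 k)) *m U.

Lemma tr_spectral_fun f : (spectral_fun f)^T = spectral_fun f.
Proof. by rewrite /spectral_fun !trmx_mul trmxK tr_diag_mx mulmxA. Qed.

Lemma eq_spectral_fun f g :
  (forall k, f (nu 0 k) = g (nu 0 k)) -> spectral_fun f = spectral_fun g.
Proof.
by move=> fg; congr (_ *m diag_mx _ *m _); apply/rowP => k; rewrite !mxE.
Qed.

Lemma spectral_funM f g :
  spectral_fun f *m spectral_fun g = spectral_fun (fun x => f x * g x).
Proof.
rewrite /spectral_fun !mulmxA -[_ *m U *m U^T]mulmxA UU mulmx1.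
rewrite -[_ *m diag_mx _ *m diag_mx _]mulmxA mulmx_diag; congr (_ *m diag_mx _ *m _).
by apply/rowP => k; rewrite !mxE.
Qed.

Lemma spectral_funD f g :
  spectral_fun f + spectral_fun g = spectral_fun (fun x => f x + g x).
Proof.
rewrite -mulmxDl -mulmxDr -raddfD/=; congr (_ *m diag_mx _ *m _).
by apply/rowP => k; rewrite !mxE.
Qed.

Lemma spectral_fun_cst c : spectral_fun (fun=> c) = c%:M.
Proof.
rewrite /spectral_fun (_ : \row_k c = const_mx c); last by apply/rowP => k; rewrite !mxE.
by rewrite diag_const_mx mul_mx_scalar -scalemxAl (mulmx1C UU) scalemx1.
Qed.

Lemma mxtrace_spectral_fun f : \tr (spectral_fun f) = \sum_k f (nu 0 k).
Proof.
rewrite mxtrace_mulC mulmxA UU mul1mx mxtrace_diag.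
by apply: eq_bigr => k _; rewrite mxE.
Qed.

Lemma sqnorm_mul_spectral_fun f u :
  sqnorm (u *m spectral_fun f) = dotv (u *m spectral_fun (fun x => f x ^+ 2)) u.
Proof.
by rewrite /sqnorm dotv_mulmxr tr_spectral_fun -mulmxA spectral_funM.
Qed.

Lemma sqnorm_mul_spectral_fun_le f u : (forall k, f (nu 0 k) ^+ 2 <= 1) ->
  sqnorm (u *m spectral_fun f) <= sqnorm u.
Proof.
move=> f_le1; pose g x := Num.sqrt (1 - f x ^+ 2).
have := sqnorm_ge0 (u *m spectral_fun g); rewrite !sqnorm_mul_spectral_fun.
rewrite (@eq_spectral_fun (fun x => g x ^+ 2) (fun x => 1 + -1 * f x ^+ 2)); last first.
  by move=> k; rewrite sqr_sqrtr ?subr_ge0// mulN1r.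
rewrite -(spectral_funD (fun=> 1)) -(spectral_funM (fun=> -1)) !spectral_fun_cst.
by rewrite mulmxDr mulmx1 mul_scalar_mx -scalemxAr dotvDl dotvZl -/(sqnorm u); lra.
Qed.

End spectral_calculus.

(** * Exponential averages over random signs *)

Section random_signs.
Context {R : realType}.

Definition seq_mean (T : Type) (s : seq T) (f : T -> R) : R :=
  (size s)%:R^-1 * \sum_(t <- s) f t.

Context {V : lmodType R}.
Implicit Types (a t u : V) (l : seq V).

Fixpoint sign_sums l : seq V :=
  if l is a :: l' then
    [seq a + t | t <- sign_sums l'] ++ [seq - a + t | t <- sign_sums l']
  else [:: 0].

Lemma size_sign_sums_gt0 l : (0 < size (sign_sums l))%N.
Proof. by elim: l => //= a l ih; rewrite size_cat size_map addn_gt0 ih. Qed.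

Lemma sign_sums_mean_cons a l (f : V -> R) : seq_mean (sign_sums (a :: l)) f =
  (seq_mean (sign_sums l) (fun t => f (a + t)) +
   seq_mean (sign_sums l) (fun t => f (- a + t))) / 2.
Proof.
have size_neq0 : (size (sign_sums l))%:R != 0 :> R.
  by rewrite pnatr_eq0 -lt0n size_sign_sums_gt0.
rewrite /seq_mean/= size_cat !size_map big_cat/= !big_map natrD.
by field; rewrite size_neq0 -mulr2n mulrn_eq0.
Qed.

Variables (f q : V -> R) (b : V -> V -> R).
Hypothesis f_quadratic : forall u a s, f (u + s *: a) = f u + s * b u a - s ^+ 2 * q a.
Hypothesis q_ge0 : forall a, 0 <= q a.

Lemma tilted_mean_ge u a y :
  f (u + y *: a) - q a <= (1 + y) / 2 * f (u + a) + (1 - y) / 2 * f (u - a).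
Proof.
have fD : f (u + a) = f u + b u a - q a.
  by rewrite -[a in LHS]scale1r f_quadratic mul1r expr1n mul1r.
have fB : f (u - a) = f u - b u a - q a.
  by rewrite -scaleN1r f_quadratic mulN1r sqrrN expr1n mul1r.
rewrite fD fB f_quadratic -subr_ge0 [X in 0 <= X](_ : _ = y ^+ 2 * q a); last by field.
by rewrite mulr_ge0 ?sqr_ge0.
Qed.

(* Jensen's inequality for the law of the signs tilted to have means [y]. *)
Lemma expR_sign_sums_mean_ge l (y : V -> R) u : {in l, forall a, `|y a| < 1} ->
  expR (f (u + \sum_(a <- l) y a *: a) - \sum_(a <- l) (q a + y a ^+ 2)) <=
  seq_mean (sign_sums l) (fun t => expR (f (u + t))).
Proof.
elim: l u => [|a l ih] u y_lt1.
  by rewrite /seq_mean/= big_seq1 !big_nil subr0 invr1 mul1r.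
have ya_lt1 : `|y a| < 1 by apply: y_lt1; rewrite mem_head.
have {}ih v := ih v (sub_in1 (mem_subseq (subseq_cons l a)) y_lt1).
rewrite sign_sums_mean_cons !big_cons.
set w := \sum_(a' <- l) y a' *: a' in ih *.
set c := \sum_(a' <- l) (q a' + y a' ^+ 2) in ih *.
have := lerD (ih (u + a)) (ih (u - a)).
under [X in (seq_mean _ X + _) / _]eq_fun do rewrite addrA.
under [X in (_ + seq_mean _ X) / _]eq_fun do rewrite addrA.
rewrite -/w -/c -(ler_pM2r (_ : 0 < 2^-1))// => /(le_trans _); apply.
apply: le_trans (expR_tilted_mean_le _ _ ya_lt1); rewrite ler_expR.
have := tilted_mean_ge (u + w) a (y a).
rewrite (addrAC u w a) (addrAC u w (- a)) [y a *: a + w]addrC [u + (w + _)]addrA; lra.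
Qed.

End random_signs.

Section axis_steps.
Context {R : realType} {d : nat}.
Implicit Types (a t u x : 'rV[R]_d).

Definition axis_steps (c : R) (m : nat) : seq 'rV[R]_d :=
  [seq c *: delta_mx 0 k | k <- enum 'I_d, _ <- iota 0 m].

Lemma sum_axis_steps (W : nmodType) (G : 'rV[R]_d -> W) c m :
  \sum_(a <- axis_steps c m) G a = \sum_k G (c *: delta_mx 0 k) *+ m.
Proof.
rewrite big_allpairs_dep big_enum; apply: eq_bigr => k _.
by rewrite big_const_seq count_predT size_iota iter_addr_0.
Qed.

Variables (q : 'rV[R]_d -> R) (b : 'rV[R]_d -> 'rV[R]_d -> R) (S : R).
Hypothesis q_quadratic :
  forall u a s, q (u + s *: a) = q u + 2 * s * b u a + s ^+ 2 * q a.
Hypothesis qZ : forall s a, q (s *: a) = s ^+ 2 * q a.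
Hypothesis q_ge0 : forall u, 0 <= q u.
Hypothesis q_le : forall t, q t <= S * sqnorm t.
Local Notation q_trace := (\sum_k q (delta_mx 0 k)).

(* Tilting the sign of each step [a] by [dotv a x' / 2] gives their sum the mean
   [(beta / 2) *: x']. *)
Lemma axis_steps_sign_mean_ge c m beta x x' : c ^+ 2 * sqnorm x' < 4 ->
  m%:R * c ^+ 2 = beta ->
  expR (beta / 2 * dotv x' x - S * ((beta / 2) ^+ 2 * sqnorm x') -
        beta * (q_trace + sqnorm x' / 4)) <=
  seq_mean (sign_sums (axis_steps c m)) (fun t => expR (dotv t x - q t)).
Proof.
move=> c_small mc_sqr.
have f_quadratic u a s : dotv (u + s *: a) x - q (u + s *: a) =
    (dotv u x - q u) + s * (dotv a x - 2 * b u a) - s ^+ 2 * q a.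
  by rewrite q_quadratic dotvDl dotvZl; ring.
have tilt_lt1 : {in axis_steps c m, forall a, `|dotv a x' / 2| < 1}.
  move=> _ /allpairsP[[k i] [_ _ ->]] /=; rewrite dotvZl dotv_deltal.
  rewrite -(expr_lt1 (n := 2))// real_normK ?num_real// expr_div_n exprMn.
  by have := ler_wpM2l (sqr_ge0 c) (sqr_coord_le x' k); lra.
have := expR_sign_sums_mean_ge f_quadratic q_ge0 0 tilt_lt1; rewrite add0r.
under [in X in _ <= X -> _]eq_fun do rewrite add0r.
apply: le_trans; rewrite ler_expR/=.
have -> : \sum_(a <- axis_steps c m) (dotv a x' / 2) *: a = (beta / 2) *: x'.
  rewrite sum_axis_steps [in RHS](row_sum_delta x') scaler_sumr; apply: eq_bigr => k _.
  by rewrite -scaler_nat !scalerA -mc_sqr dotvZl dotv_deltal; congr (_ *: _); field.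
have -> : \sum_(a <- axis_steps c m) (q a + (dotv a x' / 2) ^+ 2) =
    beta * (q_trace + sqnorm x' / 4).
  rewrite sum_axis_steps sqnormE mulr_suml -big_split/= mulr_sumr; apply: eq_bigr => k _.
  by rewrite -[LHS]mulr_natl qZ dotvZl dotv_deltal -mc_sqr; field.
by rewrite dotvZl; have := q_le ((beta / 2) *: x'); rewrite sqnormZ; lra.
Qed.

Lemma exists_sign_mixture r : 0 < S -> 0 <= r ->
  exists ts : seq 'rV[R]_d, (0 < size ts)%N /\
    forall x, r <= sqnorm x ->
    expR ((r / 16 - q_trace / 2) / S) <= seq_mean ts (fun t => expR (dotv t x - q t)).
Proof.
move=> S_gt0 r_ge0.
pose beta : R := (2 * S)^-1; have beta_gt0 : 0 < beta by rewrite invr_gt0 mulr_gt0.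
pose m := (Num.bound (beta * r)).+1; have m_gt0 : 0 < m%:R :> R by rewrite ltr0n.
pose c := Num.sqrt (beta / m%:R).
have c_sqr : c ^+ 2 = beta / m%:R by rewrite sqr_sqrtr// divr_ge0// ltW.
exists (sign_sums (axis_steps c m)); split=> [|x x_large]; first exact: size_sign_sums_gt0.
have [|x' sqnorm_x' dot_x'] := @exists_shrink _ _ x r; first by rewrite r_ge0.
have c_small : c ^+ 2 * sqnorm x' < 4.
  rewrite c_sqr sqnorm_x' mulrAC ltr_pdivrMr//.
  have := archi_boundP (mulr_ge0 (ltW beta_gt0) r_ge0).
  by have := ler0n R (Num.bound (beta * r)); rewrite /m -natr1; lra.
have mc_sqr : m%:R * c ^+ 2 = beta by rewrite c_sqr mulrC divfK// gt_eqF.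
apply: le_trans (axis_steps_sign_mean_ge x c_small mc_sqr); rewrite ler_expR sqnorm_x'.
have -> : (r / 16 - q_trace / 2) / S =
    beta / 2 * r - S * ((beta / 2) ^+ 2 * r) - beta * (q_trace + r / 4).
  by rewrite /beta; field; rewrite gt_eqF.
by have := ler_wpM2l (ltW beta_gt0) dot_x'; lra.
Qed.

End axis_steps.

(** * Integration *)

Section integral_of_products.
Local Open Scope ereal_scope.
Context {R : realType}.

Lemma measurable_set_pred (d : measure_display) (T : measurableType d) (p : T -> bool) :
  measurable_fun setT p -> measurable [set x | p x].
Proof.
by move=> mp; have := mp measurableT [set true]; rewrite setTI; apply.
Qed.

Lemma ge0_integralM_layer_cake (d : measure_display) (T : measurableType d)
    (mu : {sigma_finite_measure set T -> \bar R}) (f : T -> \bar R) (k : T -> R) :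
  measurable_fun setT f -> (forall x, 0 <= f x) ->
  measurable_fun setT k -> (forall x, 0 <= k x)%R ->
  \int[mu]_x (f x * (k x)%:E) =
  \int[lebesgue_measure]_(t in `[0%R, +oo[) \int[mu]_(x in [set x | t < k x]%R) f x.
Proof.
move=> mf f_ge0 mk k_ge0.
pose A := [set z : T * measurableTypeR R | (0 <= z.2) && (z.2 < k z.1)]%R.
have mA : measurable A.
  apply: measurable_set_pred; apply: measurable_and.
    exact: measurable_fun_ler measurable_snd.
  by apply: measurable_fun_ltr; [exact: measurable_snd|exact: measurableT_comp].
pose F z := f z.1 * (\1_A z)%:E.
have mF : measurable_fun setT F.
  by apply: emeasurable_funM; [exact: measurableT_comp|exact/measurable_EFinP].
have F_ge0 z : 0 <= F z by rewrite mule_ge0// lee_fin.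
transitivity (\int[mu]_x \int[lebesgue_measure]_t F (x, t)).
  apply: eq_integral => x _; rewrite /F/= ge0_integralZl//; last first.
    apply/measurable_EFinP.
    exact: (measurableT_comp (measurable_indic mA) (pair1_measurable x)).
  congr (_ * _); rewrite (_ : (fun t => _) = EFin \o \1_(`[0%R, k x[)); last first.
    by apply/funext => t; rewrite /= !indicE /A !mem_setE in_itv.
  rewrite integral_indic//= setIT lebesgue_measure_itv/= lte_fin.
  have := k_ge0 x; rewrite le_eqVlt => /predU1P[<-|kx_gt0]; first by rewrite ltxx.
  by rewrite kx_gt0 oppr0 adde0.
rewrite (fubini_tonelli _ mF)// [RHS]integral_mkcond; apply: eq_integral => t _.
rewrite patchE mem_setE in_itv/= andbT; case: ifPn => [t_ge0|/negPf t_ge0].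
  rewrite [RHS]integral_mkcond epatch_indic; apply: eq_integral => x _.
  by rewrite /F/= !indicE /A !mem_setE !unfold_in/= t_ge0.
by apply: (@integral0_eq _ _ _ mu) => x _; rewrite /F indicE /A mem_setE unfold_in/= t_ge0 mule0.
Qed.

Lemma ge0_integralM_comp_eq (d1 d2 d' : measure_display) (T1 : measurableType d1)
    (T2 : measurableType d2) (T' : measurableType d')
    (mu1 : {sigma_finite_measure set T1 -> \bar R})
    (mu2 : {sigma_finite_measure set T2 -> \bar R})
    (Z1 : T1 -> T') (Z2 : T2 -> T') (f1 : T1 -> \bar R) (f2 : T2 -> \bar R)
    (h : T' -> R) :
  measurable_fun setT Z1 -> measurable_fun setT Z2 ->
  measurable_fun setT f1 -> measurable_fun setT f2 ->
  (forall x, 0 <= f1 x) -> (forall x, 0 <= f2 x) ->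
  (forall A, measurable A ->
    \int[mu1]_(x in Z1 @^-1` A) f1 x = \int[mu2]_(x in Z2 @^-1` A) f2 x) ->
  measurable_fun setT h -> (forall y, 0 <= h y)%R ->
  \int[mu1]_x (f1 x * (h (Z1 x))%:E) = \int[mu2]_x (f2 x * (h (Z2 x))%:E).
Proof.
move=> mZ1 mZ2 mf1 mf2 f1_ge0 f2_ge0 f12 mh h_ge0.
have [mhZ1 mhZ2] := (measurableT_comp mh mZ1, measurableT_comp mh mZ2).
rewrite (ge0_integralM_layer_cake mu1 mf1 f1_ge0 mhZ1 (fun x => h_ge0 (Z1 x))).
rewrite (ge0_integralM_layer_cake mu2 mf2 f2_ge0 mhZ2 (fun x => h_ge0 (Z2 x))).
apply: eq_integral => t _; apply: (f12 [set y | t < h y]%R).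
by apply: measurable_set_pred; exact: measurable_fun_ltr.
Qed.

End integral_of_products.

Lemma markov_le1 (R : realType) (d : measure_display) (T : measurableType d)
    (P : probability T R) (f : T -> R) (eps : R) :
  measurable_fun setT f -> (forall x, 0 <= f x) -> (\int[P]_x (f x)%:E <= 1)%E ->
  0 < eps -> (P [set x | eps^-1 <= f x]%R <= eps%:E)%E.
Proof.
move=> mf f_ge0 int_le1 eps_gt0; have /measurable_EFinP mfE := mf.
have := le_integral_abse P measurableT mfE (_ : 0 < eps^-1)%R.
rewrite invr_gt0 setTI => /(_ eps_gt0).
under eq_integral do rewrite gee0_abs ?lee_fin//.
rewrite (_ : [set x | _] = [set x | eps^-1 <= f x]); last first.
  by apply/seteqP; split => x /=; rewrite lee_fin ger0_norm.
by move=> /le_trans/(_ int_le1); rewrite lee_pdivrMl// mule1.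
Qed.

Section expectation.
Context {R : realType} {d : measure_display} {T : measurableType d}.
Variable P : probability T R.
Implicit Types f g : T -> R.

Lemma Lfun_measurable p f : f \in Lfun P p -> measurable_fun setT f.
Proof. by move=> /sub_Lfun_mfun; rewrite inE. Qed.

Lemma Lfun1_le f g : measurable_fun setT f -> (forall z, `|f z| <= g z) ->
  g \in Lfun P 1 -> f \in Lfun P 1.
Proof.
move=> mf fg /Lfun1_integrable g_L1; apply/Lfun1_integrable.
apply: (le_integrable measurableT _ _ g_L1); first exact/measurable_EFinP.
by move=> z _; rewrite /= lee_fin (le_trans (fg z))// ler_norm.
Qed.

Lemma Lfun2_sqrP f : f \in Lfun P 2%:E <->
  measurable_fun setT f /\ (fun z => f z ^+ 2) \in Lfun P 1.
Proof.
split=> [f_L2|[mf /Lfun1_integrable/integrableP[_ f_sqr_lty]]].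
  by split; [exact: Lfun_measurable f_L2|exact/Lfun1_integrable/Lfun2_integrable_sqr].
rewrite inE; apply/andP; split; rewrite inE//= /finite_norm unlock poweR_lty//.
apply: le_lt_trans f_sqr_lty; rewrite le_eqVlt; apply/orP; left; apply/eqP.
by apply: eq_integral => z _; rewrite /= powR_mulrn// normrX.
Qed.

Lemma Lfun2_Lfun1 f : f \in Lfun P 2%:E -> f \in Lfun P 1.
Proof. by apply: Lfun_subset12; exact: fin_num_measure. Qed.

Lemma Lfun_sum p (I : Type) (s : seq I) (F : I -> T -> R) : (1 <= p)%E ->
  (forall i, F i \in Lfun P p) -> (fun z => \sum_(i <- s) F i z) \in Lfun P p.
Proof. by move=> p_ge1 F_L1; rewrite -fct_sumE; apply: rpred_sum. Qed.

Lemma expectE f : f \in Lfun P 1 -> (\int[P]_z (f z)%:E = (expect P f)%:E)%E.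
Proof. by move=> /Lfun1_integrable f_L1; rewrite fineK// integrable_fin_num. Qed.

Lemma eq_expect f g : f =1 g -> expect P f = expect P g.
Proof. by move=> fg; congr expect; exact/funext. Qed.

Lemma ae_eq_expect f g : measurable_fun setT f -> measurable_fun setT g ->
  (\forall z \ae P, f z = g z) -> expect P f = expect P g.
Proof.
move=> mf mg fg; congr fine; apply: ae_eq_integral => //; [exact/measurable_EFinP..|].
by apply: filterS fg => z fgz _; rewrite fgz.
Qed.

Lemma expectD f g : f \in Lfun P 1 -> g \in Lfun P 1 ->
  expect P (fun z => f z + g z) = expect P f + expect P g.
Proof. by move=> /Lfun1_integrable f_L1 /Lfun1_integrable g_L1; exact: RintegralD. Qed.

Lemma expectZ c f : f \in Lfun P 1 -> expect P (fun z => c * f z) = c * expect P f.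
Proof. by move=> /Lfun1_integrable f_L1; exact: RintegralZl. Qed.

Lemma expect_cst c : expect P (fun=> c) = c.
Proof. by rewrite [LHS]Rintegral_cst// [X in _ * fine X]probability_setT mulr1. Qed.

Lemma expect_sum (I : Type) (s : seq I) (F : I -> T -> R) :
  (forall i, F i \in Lfun P 1) ->
  expect P (fun z => \sum_(i <- s) F i z) = \sum_(i <- s) expect P (F i).
Proof.
move=> F_L1; elim: s => [|i s ih].
  by rewrite big_nil -[RHS](expect_cst 0); apply: eq_expect => z; rewrite big_nil.
rewrite big_cons -ih -expectD//; last exact: Lfun_sum.
by apply: eq_expect => z; rewrite big_cons.
Qed.

Lemma expect_ge0 f : (forall z, 0 <= f z) -> 0 <= expect P f.
Proof. by move=> f_ge0; exact: Rintegral_ge0. Qed.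

Lemma le_expect f g : f \in Lfun P 1 -> g \in Lfun P 1 -> (forall z, f z <= g z) ->
  expect P f <= expect P g.
Proof.
by move=> /Lfun1_integrable f_L1 /Lfun1_integrable g_L1 fg; apply: le_Rintegral => // z _.
Qed.

Lemma expect_eq0_ae f : f \in Lfun P 1 -> (forall z, 0 <= f z) -> expect P f = 0 ->
  \forall z \ae P, f z = 0.
Proof.
move=> f_L1 f_ge0 Ef0; have mf : measurable_fun setT (EFin \o f).
  by apply/measurable_EFinP; exact: Lfun_measurable f_L1.
have /(ae_eq_integral_abs _ measurableT mf) : (\int[P]_z `|(f z)%:E| = 0)%E.
  under eq_integral do rewrite gee0_abs ?lee_fin//.
  by rewrite expectE// Ef0.
by apply: filterS => z /(_ I) [].
Qed.

End expectation.

(** * Independent samples *)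

Section iid_sampling.
Context {R : realType} {d : measure_display} {T : measurableType d}.
Variable P : probability T R.
Context {dO : measure_display} {O : measurableType dO}.
Variables (Pr : probability O R) (n : nat) (Z : 'I_n -> O -> T).
Hypothesis iidZ : iid_sample P Pr Z.

Lemma iid_measurable i : measurable_fun setT (Z i).
Proof. by case: iidZ. Qed.

Lemma iid_measurable_preimage i A : measurable A -> measurable (Z i @^-1` A).
Proof. by move=> mA; have := iid_measurable i measurableT mA; rewrite setTI. Qed.

Lemma iid_preimage i A : measurable A -> Pr (Z i @^-1` A) = P A.
Proof. by case: iidZ => _ [ZP _]; exact: ZP. Qed.

Lemma iid_integral_prod_indic (A : 'I_n -> set T) : (forall i, measurable (A i)) ->
  (\int[Pr]_w (\prod_i \1_(A i) (Z i w))%:E = (\prod_i fine (P (A i)))%:E)%E.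
Proof.
move=> mA; have [_ [_ Zindep]] := iidZ.
have mcap : measurable (\bigcap_(i in [set: 'I_n]) (Z i @^-1` A i)).
  by apply: fin_bigcap_measurable => // i _; exact: iid_measurable_preimage.
rewrite (eq_bigr (fun i => fine (Pr (Z i @^-1` A i)))) => [|i _]; last first.
  by rewrite iid_preimage.
rewrite -Zindep// fineK ?fin_num_measure// -[in RHS](setIT (bigcap _ _)).
rewrite -integral_indic//; apply: eq_integral => w _; congr _%:E.
have [capw|] := pselect ((\bigcap_(i in [set: 'I_n]) (Z i @^-1` A i)) w).
  by rewrite indicE mem_set// big1// => i _; rewrite indicE mem_set//; exact: capw.
move=> /[dup] ncapw /existsNP[i /not_implyP[_ nAi]].
by rewrite indicE memNset// (bigD1 i)//= indicE memNset// mul0r.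
Qed.

Lemma iid_integralM_comp (f : O -> R) (c : R) (h : T -> R) j :
  measurable_fun setT f -> (forall w, 0 <= f w) ->
  (forall B, measurable B ->
    \int[Pr]_w (f w * \1_B (Z j w))%:E = (c * fine (P B))%:E)%E ->
  h \in Lfun P 1 -> (forall x, 0 <= h x) ->
  (\int[Pr]_w (f w * h (Z j w))%:E = (c * expect P h)%:E)%E.
Proof.
move=> mf f_ge0 fB h_L1 h_ge0; have mh := Lfun_measurable h_L1.
have c_ge0 : 0 <= c.
  have := fB _ measurableT; rewrite [P _]probability_setT mulr1 -lee_fin => <-.
  by apply: integral_ge0 => w _; rewrite lee_fin mulr_ge0.
under eq_integral do rewrite EFinM.
rewrite (ge0_integralM_comp_eq (mu2 := P) (Z2 := id) (f2 := cst c%:E))//.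
- rewrite ge0_integralZl ?lee_fin//= ?expectE//; first exact/measurable_EFinP.
  by move=> x _; rewrite lee_fin.
- exact: iid_measurable.
- exact/measurable_EFinP.
- move=> B mB; rewrite integral_cst// -[X in (_ * X)%E]fineK ?fin_num_measure// -EFinM -fB//.
  by rewrite integral_mkcond epatch_indic.
Qed.

Lemma iid_integral_prod (h : 'I_n -> T -> R) :
  (forall i, h i \in Lfun P 1) -> (forall i x, 0 <= h i x) ->
  (\int[Pr]_w (\prod_i h i (Z i w))%:E = (\prod_i expect P (h i))%:E)%E.
Proof.
have expect_indic B : measurable B -> expect P \1_B = fine (P B).
  by move=> mB; rewrite /expect integral_indic ?setIT.
move=> h_L1 h_ge0.
suff partially_indic J : (J <= n)%N -> forall h : 'I_n -> T -> R,
    (forall i, h i \in Lfun P 1) -> (forall i x, 0 <= h i x) ->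
    (forall i : 'I_n, (J <= i)%N -> exists2 A, measurable A & h i = \1_A) ->
    (\int[Pr]_w (\prod_i h i (Z i w))%:E = (\prod_i expect P (h i))%:E)%E.
  by apply: (partially_indic n) => // i; rewrite leqNgt ltn_ord.
elim: J => [_ {h_L1 h_ge0}h h_L1 h_ge0 h_indic|J ih Jn {h_L1 h_ge0}h h_L1 h_ge0 h_indic].
  have /choice[A AP] i : exists A, measurable A /\ h i = \1_A.
    by have [A mA ->] := h_indic i (leq0n i); exists A.
  have -> : h = fun i => \1_(A i) by apply/funext => i; case: (AP i).
  rewrite iid_integral_prod_indic => [|i]; last by case: (AP i).
  by congr _%:E; apply: eq_bigr => i _; rewrite expect_indic//; case: (AP i).
pose j := Ordinal Jn; under eq_integral do rewrite (bigD1 j)//= mulrC.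
rewrite [in RHS](bigD1 j)//= mulrC; apply: iid_integralM_comp => // [|w|B mB].
- under eq_fun do rewrite -big_filter; apply: measurable_prod => i _.
  exact: measurableT_comp (Lfun_measurable (h_L1 i)) (iid_measurable i).
- exact: prodr_ge0.
pose h_ i : T -> R := if i == j then \1_B else h i.
have h_j : h_ j = \1_B by rewrite /h_ eqxx.
have h_other i : i != j -> h_ i = h i by rewrite /h_ => /negPf ->.
have : (\int[Pr]_w (\prod_i h_ i (Z i w))%:E = (\prod_i expect P (h_ i))%:E)%E.
  apply: ih => [|i|i x|i Ji]; rewrite ?(ltnW Jn)// /h_.
  - by case: ifP => // _; apply/Lfun1_integrable; exact: integrable_indic.
  - by case: ifP.
  - case: ifPn => [_|ij]; first by exists B.
    by apply: h_indic; rewrite ltn_neqAle Ji andbT eq_sym; exact: contra ij.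
rewrite (bigD1 j)//= h_j expect_indic// (eq_bigr (fun i => expect P (h i))); last first.
  by move=> i ij; rewrite h_other.
rewrite mulrC => <-; apply: eq_integral => w _.
rewrite [in RHS](bigD1 j)//= h_j mulrC; congr (_ * _)%:E.
by apply: eq_bigr => i ij; rewrite h_other.
Qed.

End iid_sampling.

Lemma measure_bigsetU_le (R : realType) (d : measure_display) (T : measurableType d)
    (mu : {measure set T -> \bar R}) (I : Type) (s : seq I) (A : I -> set T) :
  (forall i, measurable (A i)) ->
  (mu (\big[setU/set0]_(i <- s) A i) <= \sum_(i <- s) mu (A i))%E.
Proof.
move=> mA; elim: s => [|i s ih]; first by rewrite !big_nil measure0.
rewrite !big_cons; apply: le_trans (leeD (lexx _) ih).
by apply: measureU2 => //; exact: bigsetU_measurable.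
Qed.

Section high_probability.
Context {R : realType} {d : measure_display} {T : measurableType d}.
Variable P : probability T R.
Implicit Type good : forall n, ('I_n -> T) -> Prop.

Definition eventually_whp (eps : R) good : Prop :=
  exists N : nat, forall n, (N <= n)%N ->
  forall (dO : measure_display) (O : measurableType dO) (Pr : probability O R)
    (Z : 'I_n -> O -> T), iid_sample P Pr Z ->
  exists B : set O, [/\ measurable B, (Pr B <= eps%:E)%E &
    forall w, ~ B w -> good n (Z ^~ w)].

Lemma eventually_whp_impl eps good good' : (forall n s, good n s -> good' n s) ->
  eventually_whp eps good -> eventually_whp eps good'.
Proof.
move=> imp [N good_from_N]; exists N => n Nn dO O Pr Z iidZ.
have [B [mB PB goodB]] := good_from_N n Nn _ _ Pr Z iidZ.
by exists B; split => // w /goodB; exact: imp.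
Qed.

Lemma eventually_whp_le eps eps' good : eps <= eps' ->
  eventually_whp eps good -> eventually_whp eps' good.
Proof.
move=> eps_le [N good_from_N]; exists N => n Nn dO O Pr Z iidZ.
have [B [mB PB goodB]] := good_from_N n Nn _ _ Pr Z iidZ.
by exists B; split => //; apply: le_trans PB _; rewrite lee_fin.
Qed.

Lemma eventually_whp_and eps eps' good good' :
  eventually_whp eps good -> eventually_whp eps' good' ->
  eventually_whp (eps + eps') (fun n s => good n s /\ good' n s).
Proof.
move=> [N good_from_N] [N' good_from_N']; exists (maxn N N') => n; rewrite geq_max => /andP[Nn N'n].
move=> dO O Pr Z iidZ.
have [B [mB PB goodB]] := good_from_N n Nn _ _ Pr Z iidZ.
have [B' [mB' PB' goodB']] := good_from_N' n N'n _ _ Pr Z iidZ.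
exists (B `|` B'); split; first exact: measurableU.
  by rewrite EFinD (le_trans (measureU2 _ _ _))// leeD.
by move=> w /not_orP[/goodB ? /goodB' ?].
Qed.

Lemma eventually_whp_size_ge N : eventually_whp 0 (fun n _ => (N <= n)%N).
Proof. by exists N => n Nn *; exists set0; split => //; rewrite measure0. Qed.

Lemma eventually_whp_forall (eps : R) (bad : nat -> set T) :
  (forall n, measurable (bad n)) ->
  (exists N, forall n, (N <= n)%N -> n%:R%:E * P (bad n) <= eps%:E)%E ->
  eventually_whp eps (fun n s => forall i, ~ bad n (s i)).
Proof.
move=> mbad [N P_bad_le]; exists N => n Nn dO O Pr Z iidZ.
exists (\big[setU/set0]_i (Z i @^-1` bad n)); split.
- by apply: bigsetU_measurable => i _; exact: iid_measurable_preimage iidZ _ _ _.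
- apply: le_trans (P_bad_le n Nn).
  rewrite (le_trans (measure_bigsetU_le _ _ _))// => [i|].
    exact: iid_measurable_preimage iidZ _ _ _.
  rewrite (eq_bigr (fun=> P (bad n))) => [|i _]; last exact: iid_preimage iidZ _ _ _.
  rewrite -[P _]fineK ?fin_num_measure// sumEFin sumr_const card_ord.
  by rewrite -EFinM mulr_natl.
- by move=> w nbad i badi; apply: nbad; rewrite (bigD1 i)//=; left.
Qed.

Lemma eventually_whp_forall_ae (p : T -> Prop) : (\forall z \ae P, p z) ->
  eventually_whp 0 (fun n s => forall i, p (s i)).
Proof.
move=> [N [mN PN pN]].
apply: (eventually_whp_impl (good := fun n s => forall i, ~ N (s i))).
  by move=> n s nN i; apply: contrapT => /pN; exact: nN.
by apply: (eventually_whp_forall (bad := fun=> N)) => //; exists 0%N => n _; rewrite PN mule0.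
Qed.

Lemma tail_probability_small (W : T -> R) (kappa eps : R) :
  W \in Lfun P 1 -> (forall x, 0 <= W x) -> 0 < kappa -> 0 < eps ->
  exists N, forall n, (N <= n)%N ->
    (n%:R%:E * P [set x | kappa * n%:R < W x]%R <= eps%:E)%E.
Proof.
move=> W_L1 W_ge0 kappa_gt0 eps_gt0; have mW := Lfun_measurable W_L1.
pose B n := [set x | kappa * n%:R < W x].
have mB n : measurable (B n) by apply: measurable_set_pred; exact: measurable_fun_ltr.
pose F n x : \bar R := (n%:R * \1_(B n) x)%:E.
have : (\int[P]_x F n x @[n --> \oo] --> \int[P]_x (cst 0 x))%E.
  apply: (@dominated_cvg _ _ _ P _ _ F _ (EFin \o (fun x => kappa^-1 * W x))) => //.
  - by move=> n; apply/measurable_EFinP; apply: measurable_funM.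
  - move=> x _; apply: cvg_near_cst; exists (Num.bound (W x / kappa)) => // n /= xn.
    rewrite /F indicE memNset ?mulr0// /B/=; apply/negP; rewrite -leNgt.
    rewrite mulrC -ler_pdivrMr// (le_trans (ltW (archi_boundP _))) ?ler_nat//.
    by rewrite divr_ge0// ltW.
  - by apply/Lfun1_integrable; exact: rpredZ.
  - move=> n x _; rewrite /= lee_fin ger0_norm ?mulr_ge0// indicE.
    case: (boolP (x \in B n)) => [/set_mem/ltW xn|_].
      by rewrite mulr1 [leRHS]mulrC ler_pdivlMr// mulrC.
    by rewrite mulr0 mulr_ge0// invr_ge0 ltW.
rewrite integral0 => /(_ [set y | y < eps%:E]%E)[|N _ tail_le].
  by apply: open_ereal_lt'; rewrite lte_fin.
exists N => n /tail_le/= /ltW; rewrite (eq_integral (fun x => n%:R%:E * (\1_(B n) x)%:E)%E)//.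
rewrite ge0_integralZl// ?lee_fin//; last exact/measurable_EFinP.
by rewrite integral_indic// setIT.
Qed.

End high_probability.

(** * Concentration of empirical means of vectors *)

Section second_moment.
Context {R : realType} {dT : measure_display} {T : measurableType dT}.
Variable P : probability T R.
Context {d : nat}.
Variable zeta : T -> 'rV[R]_d.

Definition square_integrable : Prop := forall j, (fun z => zeta z 0 j) \in Lfun P 2%:E.

Definition mean_vec : 'rV[R]_d := \row_j expect P (fun z => zeta z 0 j).

Definition second_moment (t : 'rV[R]_d) : R := expect P (fun z => dotv t (zeta z) ^+ 2).

Definition mean_dev n (s : 'I_n -> T) : 'rV[R]_d :=
  n%:R^-1 *: \sum_i zeta (s i) - mean_vec.

Lemma second_moment_ge0 t : 0 <= second_moment t.
Proof. by apply: expect_ge0 => z; exact: sqr_ge0. Qed.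

Lemma expect_sqnorm_ge0 : 0 <= expect P (fun z => sqnorm (zeta z)).
Proof. by apply: expect_ge0 => z; exact: sqnorm_ge0. Qed.

Hypothesis zeta_L2 : square_integrable.

Lemma Lfun2_dotv t : (fun z => dotv t (zeta z)) \in Lfun P 2%:E.
Proof. by apply: Lfun_sum => // j; apply: rpredZ. Qed.

Lemma Lfun1_sqr_dotv t : (fun z => dotv t (zeta z) ^+ 2) \in Lfun P 1.
Proof. by have /Lfun2_sqrP[] := Lfun2_dotv t. Qed.

Lemma Lfun1_sqnorm : (fun z => sqnorm (zeta z)) \in Lfun P 1.
Proof. by apply: Lfun_sum => // j; exact: Lfun2_mul_Lfun1. Qed.

Lemma expect_dotv t : expect P (fun z => dotv t (zeta z)) = dotv t mean_vec.
Proof.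
rewrite expect_sum => [|j]; last by apply: rpredZ => //; exact: Lfun2_Lfun1.
by apply: eq_bigr => j _; rewrite mxE expectZ//; exact: Lfun2_Lfun1.
Qed.

Lemma second_momentZ c t : second_moment (c *: t) = c ^+ 2 * second_moment t.
Proof.
rewrite -expectZ; last exact: Lfun1_sqr_dotv.
by apply: eq_expect => z; rewrite dotvZl exprMn.
Qed.

Lemma second_moment_quadratic t u c : second_moment (t + c *: u) =
  second_moment t + 2 * c * expect P (fun z => dotv t (zeta z) * dotv u (zeta z)) +
  c ^+ 2 * second_moment u.
Proof.
have dotM_L1 : (fun z => dotv t (zeta z) * dotv u (zeta z)) \in Lfun P 1.
  by apply: Lfun2_mul_Lfun1; exact: Lfun2_dotv.
have t_sqr_L1 := Lfun1_sqr_dotv t; have u_sqr_L1 := Lfun1_sqr_dotv u.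
rewrite /second_moment -(expectZ (2 * c) dotM_L1) -(expectZ (c ^+ 2) u_sqr_L1).
rewrite -expectD ?rpredZ// -expectD ?rpredD ?rpredZ//.
by apply: eq_expect => z; rewrite dotvDl dotvZl; ring.
Qed.

Lemma expect_sqnorm_eq0_ae : expect P (fun z => sqnorm (zeta z)) = 0 ->
  \forall z \ae P, zeta z = 0.
Proof.
move=> trace_eq0; have sqnorm_zeta_ge0 z := sqnorm_ge0 (zeta z).
apply: filterS (expect_eq0_ae Lfun1_sqnorm sqnorm_zeta_ge0 trace_eq0) => z /eqP.
by rewrite sqnorm_eq0 => /eqP.
Qed.

Lemma sum_second_moment_delta :
  \sum_k second_moment (delta_mx 0 k) = expect P (fun z => sqnorm (zeta z)).
Proof.
rewrite -expect_sum => [|k]; last exact: Lfun1_sqr_dotv.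
apply: eq_expect => z; rewrite sqnormE.
by apply: eq_bigr => k _; rewrite dotv_deltal.
Qed.

Lemma second_moment_le_trace t :
  second_moment t <= expect P (fun z => sqnorm (zeta z)) * sqnorm t.
Proof.
rewrite mulrC -expectZ; last exact: Lfun1_sqnorm.
apply: le_expect => [||z]; [exact: Lfun1_sqr_dotv|apply: rpredZ; exact: Lfun1_sqnorm|].
exact: sqr_dotv_le.
Qed.

Lemma dotv_mean_dev n (s : 'I_n -> T) t : dotv t (mean_dev s) =
  n%:R^-1 * (\sum_i dotv t (zeta (s i))) - expect P (fun z => dotv t (zeta z)).
Proof. by rewrite expect_dotv dotvBr dotvZr dotv_sumr. Qed.

End second_moment.

Section measurable_vectors.
Context {R : realType} {dT : measure_display} {T : measurableType dT} {d : nat}.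
Variable zeta : T -> 'rV[R]_d.
Hypothesis mzeta : forall j, measurable_fun setT (fun z => zeta z 0 j).

Lemma measurable_dotv t : measurable_fun setT (fun z => dotv t (zeta z)).
Proof. by apply: measurable_sum => j; exact: measurable_funM. Qed.

Lemma measurable_sqnorm : measurable_fun setT (fun z => sqnorm (zeta z)).
Proof. by apply: measurable_sum => j; exact: measurable_funM. Qed.

Lemma measurable_mulmx e (M : 'M[R]_(d, e)) k :
  measurable_fun setT (fun z => (zeta z *m M) 0 k).
Proof.
by under eq_fun do rewrite mxE; apply: measurable_sum => j; exact: measurable_funM.
Qed.

End measurable_vectors.

Section square_integrable_transformations.
Context {R : realType} {dT : measure_display} {T : measurableType dT}.
Variable P : probability T R.
Context {d : nat}.
Variable zeta : T -> 'rV[R]_d.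

Lemma square_integrable_mulmx e (M : 'M[R]_(d, e)) : square_integrable P zeta ->
  square_integrable P (fun z => zeta z *m M).
Proof.
move=> zeta_L2 k; rewrite (_ : (fun z => _) = fun z => \sum_j M j k * zeta z 0 j).
  by apply: Lfun_sum => // j; apply: rpredZ.
by apply/funext => z; rewrite mxE; apply: eq_bigr => j _; rewrite mulrC.
Qed.

Lemma square_integrable_outer_sqr : (forall j, measurable_fun setT (fun z => zeta z 0 j)) ->
  (fun z => sqnorm (zeta z) ^+ 2) \in Lfun P 1 ->
  square_integrable P (fun z => outer_sqr (zeta z)).
Proof.
move=> mzeta zeta_fourth_L1 k; case/mxvec_indexP: k => i j.
rewrite (_ : (fun z => _) = fun z => zeta z 0 i * zeta z 0 j); last first.
  by apply/funext => z; rewrite mxvecE mxE big_ord1 mxE.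
have mij : measurable_fun setT (fun z => zeta z 0 i * zeta z 0 j) by exact: measurable_funM.
apply/Lfun2_sqrP; split=> //; apply: Lfun1_le zeta_fourth_L1 => [|z]; first exact: measurable_funX.
rewrite ger0_norm ?sqr_ge0// exprMn expr2.
by apply: ler_pM; rewrite ?sqr_ge0 ?sqr_coord_le.
Qed.

Lemma square_integrable_scale (r : T -> R) : measurable_fun setT r ->
  (forall j, measurable_fun setT (fun z => zeta z 0 j)) ->
  (fun z => sqnorm (zeta z) * r z ^+ 2) \in Lfun P 1 ->
  square_integrable P (fun z => r z *: zeta z).
Proof.
move=> mr mzeta rzeta_L1 j; under eq_fun do rewrite mxE.
have mrj : measurable_fun setT (fun z => r z * zeta z 0 j) by exact: measurable_funM.
apply/Lfun2_sqrP; split=> //; apply: Lfun1_le rzeta_L1 => [|z]; first exact: measurable_funX.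
rewrite ger0_norm ?sqr_ge0// exprMn mulrC.
by apply: ler_wpM2r; rewrite ?sqr_ge0 ?sqr_coord_le.
Qed.

End square_integrable_transformations.

Section exponential_proxy.
Context {R : realType} {dT : measure_display} {T : measurableType dT}.
Variable P : probability T R.
Context {d : nat}.
Variable zeta : T -> 'rV[R]_d.
Hypothesis zeta_L2 : square_integrable P zeta.

Definition scaled_dot (n : nat) (t : 'rV[R]_d) (z : T) : R :=
  dotv t (zeta z) / Num.sqrt n%:R.

Definition exp_factor n t z : R := 1 + scaled_dot n t z + scaled_dot n t z ^+ 2.

(* Dominates [expR (dotv t x - second_moment t)], where [x] is the normalised deviation
   of the empirical mean, as soon as all increments are small, but has mean at most 1
   under second moment assumptions only. *)
Definition exp_proxy n t (s : 'I_n -> T) : R :=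
  expR (- (Num.sqrt n%:R * dotv t (mean_vec P zeta)) - second_moment P zeta t) *
  \prod_i exp_factor n t (s i).

Lemma exp_factor_ge0 n t z : 0 <= exp_factor n t z.
Proof. by rewrite /exp_factor; nra. Qed.

Lemma exp_proxy_ge0 n t (s : 'I_n -> T) : 0 <= exp_proxy t s.
Proof. by rewrite mulr_ge0 ?expR_ge0// prodr_ge0// => i _; exact: exp_factor_ge0. Qed.

Lemma Lfun2_scaled_dot n t : scaled_dot n t \in Lfun P 2%:E.
Proof.
rewrite [scaled_dot n t](_ : _ = fun z => (Num.sqrt n%:R)^-1 * dotv t (zeta z)).
  by apply: rpredZ => //; exact: Lfun2_dotv.
by apply/funext => z; rewrite mulrC.
Qed.

Lemma Lfun1_exp_factor n t : exp_factor n t \in Lfun P 1.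
Proof.
have y_L2 := Lfun2_scaled_dot n t; have /Lfun2_sqrP[_ y_sqr_L1] := y_L2.
by apply: rpredD => //; apply: rpredD => //; [exact: Lfun_cst|exact: Lfun2_Lfun1].
Qed.

Lemma exp_proxy_ge n t (s : 'I_n -> T) : (0 < n)%N ->
  (forall i, `|scaled_dot n t (s i)| <= 3^-1) ->
  expR (dotv t (Num.sqrt n%:R *: mean_dev P zeta s) - second_moment P zeta t) <= exp_proxy t s.
Proof.
move=> n_gt0 small; have sqrtn_gt0 : 0 < Num.sqrt n%:R :> R by rewrite sqrtr_gt0 ltr0n.
have -> : dotv t (Num.sqrt n%:R *: mean_dev P zeta s) =
    - (Num.sqrt n%:R * dotv t (mean_vec P zeta)) + \sum_i scaled_dot n t (s i).
  rewrite dotvZr dotv_mean_dev// expect_dotv// -mulr_suml.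
  have -> : n%:R^-1 = (Num.sqrt n%:R ^+ 2)^-1 :> R by rewrite sqr_sqrtr.
  by field; rewrite gt_eqF.
rewrite addrAC expRD expR_sum ler_wpM2l ?expR_ge0//; apply: ler_prod => i _.
by rewrite expR_ge0/= expR_le_quadratic// (le_trans (ler_norm _)).
Qed.

Lemma expect_exp_factor_le n t : (0 < n)%N -> expect P (exp_factor n t) ^+ n <=
  expR (Num.sqrt n%:R * dotv t (mean_vec P zeta) + second_moment P zeta t).
Proof.
move=> n_gt0; have sqrtn_gt0 : 0 < Num.sqrt n%:R :> R by rewrite sqrtr_gt0 ltr0n.
have sqrtn2 : Num.sqrt n%:R ^+ 2 = n%:R :> R by rewrite sqr_sqrtr.
have y_L2 := Lfun2_scaled_dot n t; have y_L1 := Lfun2_Lfun1 y_L2.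
have /Lfun2_sqrP[_ y_sqr_L1] := y_L2.
have mean_y : expect P (scaled_dot n t) = (Num.sqrt n%:R)^-1 * dotv t (mean_vec P zeta).
  rewrite -expect_dotv// -expectZ; last exact/Lfun2_Lfun1/Lfun2_dotv.
  by apply: eq_expect => z; rewrite mulrC.
have mean_yy : expect P (fun z => scaled_dot n t z ^+ 2) = n%:R^-1 * second_moment P zeta t.
  rewrite -expectZ; last exact: Lfun1_sqr_dotv.
  by apply: eq_expect => z; rewrite exprMn exprVn sqrtn2 mulrC.
set a := Num.sqrt n%:R * _ + _; have aE : a = n%:R * (expect P (scaled_dot n t) +
    expect P (fun z => scaled_dot n t z ^+ 2)).
  rewrite mean_y mean_yy /a; move: sqrtn_gt0 sqrtn2.
  by set r := Num.sqrt _ => r_gt0 <-; field; rewrite gt_eqF.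
rewrite aE expRM_natl lerXn2r// ?nnegrE ?expR_ge0//.
  by apply: expect_ge0 => z; exact: exp_factor_ge0.
by rewrite !expectD ?expect_cst ?rpredD ?Lfun_cst// -addrA expR_ge1Dx.
Qed.

Section sampling.
Context {dO : measure_display} {O : measurableType dO}.
Variables (Pr : probability O R) (n : nat) (Z : 'I_n -> O -> T).
Hypotheses (n_gt0 : (0 < n)%N) (iidZ : iid_sample P Pr Z).

Lemma measurable_prod_exp_factor t :
  measurable_fun setT (fun w => \prod_i exp_factor n t (Z i w)).
Proof.
under eq_fun do rewrite -big_enum; apply: measurable_prod => i _.
apply: measurableT_comp (iid_measurable iidZ i).
exact: Lfun_measurable (Lfun1_exp_factor n t).
Qed.

Lemma measurable_exp_proxy t : measurable_fun setT (fun w => exp_proxy t (Z ^~ w)).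
Proof. by apply: measurable_funM => //; exact: measurable_prod_exp_factor. Qed.

Lemma iid_integral_exp_proxy_le1 t : (\int[Pr]_w (exp_proxy t (Z ^~ w))%:E <= 1)%E.
Proof.
under eq_integral do rewrite EFinM.
rewrite ge0_integralZl ?lee_fin ?expR_ge0//; last 2 first.
- by apply/measurable_EFinP; exact: measurable_prod_exp_factor.
- by move=> w _; rewrite lee_fin prodr_ge0// => i _; exact: exp_factor_ge0.
rewrite (iid_integral_prod iidZ (h := fun=> exp_factor n t)); last 2 first.
- by move=> _; exact: Lfun1_exp_factor.
- by move=> _ z; exact: exp_factor_ge0.
rewrite prodr_const card_ord -EFinM lee_fin.
apply: le_trans (ler_wpM2l (expR_ge0 _) (expect_exp_factor_le t n_gt0)) _.
by rewrite -expRD -opprD addNr expR0.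
Qed.

Lemma iid_integral_mean_exp_proxy_le1 ts :
  (\int[Pr]_w (seq_mean ts (fun t => exp_proxy t (Z ^~ w)))%:E <= 1)%E.
Proof.
under eq_integral do rewrite EFinM -sumEFin.
have mF t : measurable_fun setT (fun w => (exp_proxy t (Z ^~ w))%:E).
  by apply/measurable_EFinP; exact: measurable_exp_proxy.
rewrite ge0_integralZl//; last 2 first.
- exact: emeasurable_sum.
- by move=> w _; apply: sume_ge0 => t _; rewrite lee_fin exp_proxy_ge0.
rewrite ge0_integral_sum//; last by move=> t w _; rewrite lee_fin exp_proxy_ge0.
have sum_le : (\sum_(t <- ts) \int[Pr]_w (exp_proxy t (Z ^~ w))%:E <= (size ts)%:R%:E)%E.
  elim: ts => [|t ts ih]; first by rewrite big_nil.
  by rewrite big_cons /= -natr1 addrC EFinD leeD// iid_integral_exp_proxy_le1.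
apply: le_trans (lee_wpmul2l _ sum_le) _; first by rewrite lee_fin invr_ge0.
rewrite -EFinM lee_fin; have [->|ts_neq0] := eqVneq (size ts)%:R (0 : R).
  by rewrite mulr0.
by rewrite mulVf.
Qed.

End sampling.

Lemma eventually_whp_mean_exp_proxy_lt ts eps : 0 < eps ->
  eventually_whp P eps (fun n s => seq_mean ts (fun t => exp_proxy t s) < eps^-1).
Proof.
move=> eps_gt0; exists 1%N => n n_gt0 dO O Pr Z iidZ.
pose G w := seq_mean ts (fun t => exp_proxy t (Z ^~ w)).
have mG : measurable_fun setT G.
  apply: measurable_funM => //; apply: measurable_sum => t.
  exact: measurable_exp_proxy iidZ t.
have G_ge0 w : 0 <= G w.
  by rewrite mulr_ge0 ?invr_ge0// sumr_ge0// => t _; exact: exp_proxy_ge0.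
exists [set w | eps^-1 <= G w]; split.
- by apply: measurable_set_pred; exact: measurable_fun_ler.
- apply: (markov_le1 mG G_ge0 _ eps_gt0).
  exact: iid_integral_mean_exp_proxy_le1.
- by move=> w /negP; rewrite -ltNge.
Qed.

End exponential_proxy.

Section mean_concentration.
Context {R : realType} {dT : measure_display} {T : measurableType dT}.
Variable P : probability T R.
Context {d : nat}.
Variable zeta : T -> 'rV[R]_d.
Hypothesis zeta_L2 : square_integrable P zeta.

Lemma eventually_whp_scaled_dot_le (ts : seq 'rV[R]_d) eps : 0 < eps ->
  eventually_whp P eps
    (fun n s => forall i, {in ts, forall t, `|scaled_dot zeta n t (s i)| <= 3^-1}).
Proof.
move=> eps_gt0; pose M : R := 1 + \sum_(t <- ts) sqnorm t.
have M_gt0 : 0 < M by rewrite ltr_pwDl// sumr_ge0// => t _; exact: sqnorm_ge0.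
have ts_le t : t \in ts -> sqnorm t <= M.
  move=> t_ts; rewrite /M (big_rem t)//= addrCA lerDl addr_ge0// sumr_ge0// => u _.
  exact: sqnorm_ge0.
pose kappa : R := (9 * M)^-1; have kappa_gt0 : 0 < kappa by rewrite invr_gt0 mulr_gt0.
have W_L1 := Lfun1_sqnorm zeta_L2; have W_ge0 z := sqnorm_ge0 (zeta z).
apply: eventually_whp_impl (eventually_whp_forall _
  (tail_probability_small W_L1 W_ge0 kappa_gt0 eps_gt0)) => [n s small i t t_ts|n]; last first.
  apply: measurable_set_pred; apply: measurable_fun_ltr => //; exact: Lfun_measurable W_L1.
have n_gt0 : 0 < n%:R :> R by rewrite ltr0n (leq_ltn_trans _ (ltn_ord i)).
rewrite -(ler_pXn2r (_ : 0 < 2)%N) ?nnegrE// real_normK ?num_real//.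
rewrite /scaled_dot expr_div_n sqr_sqrtr// ler_pdivrMr//.
apply: le_trans (sqr_dotv_le _ _) _.
have -> : 3^-1 ^+ 2 * n%:R = M * (kappa * n%:R) :> R.
  by rewrite /kappa; field; rewrite gt_eqF.
apply: ler_pM; rewrite ?sqnorm_ge0 ?ts_le// leNgt; apply/negP; exact: small.
Qed.

Variable S : R.
Hypothesis second_moment_le : forall t, second_moment P zeta t <= S * sqnorm t.

Definition dev_bound (eps : R) : R :=
  8 * expect P (fun z => sqnorm (zeta z)) + 16 * S * ln (2 / eps).

Lemma mean_dev_concentration_gt0 eps : 0 < S -> 0 < eps <= 1 ->
  eventually_whp P eps (fun n s => n%:R * sqnorm (mean_dev P zeta s) <= dev_bound eps).
Proof.
move=> S_gt0 /andP[eps_gt0 eps_le1].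
have half_gt0 : 0 < eps / 2 by lra.
have ln_ge0 : 0 <= ln (2 / eps) by rewrite ln_ge0// ler_pdivlMr//; lra.
have bound_ge0 : 0 <= dev_bound eps.
  by rewrite addr_ge0 ?mulr_ge0 ?expect_sqnorm_ge0// ltW.
have [ts [ts_gt0 ts_large]] := exists_sign_mixture (second_moment_quadratic zeta_L2)
  (second_momentZ zeta_L2) (second_moment_ge0 P zeta) second_moment_le S_gt0 bound_ge0.
rewrite sum_second_moment_delta// in ts_large.
rewrite [eps](_ : _ = eps / 2 + (eps / 2 + 0)); last by field.
apply: eventually_whp_impl (eventually_whp_and (eventually_whp_scaled_dot_le ts half_gt0)
  (eventually_whp_and (eventually_whp_mean_exp_proxy_lt zeta_L2 ts half_gt0)
    (eventually_whp_size_ge P 1))) => n s [small [proxy_lt n_gt0]].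
rewrite addr0 -splitr leNgt; apply/negP => dev_gt.
move: proxy_lt; apply/negP; rewrite -leNgt.
have := ts_large (Num.sqrt n%:R *: mean_dev P zeta s).
rewrite sqnormZ sqr_sqrtr// => /(_ (ltW dev_gt)).
have -> : (dev_bound eps / 16 - expect P (fun z => sqnorm (zeta z)) / 2) / S = ln (2 / eps).
  by rewrite /dev_bound; field; rewrite gt_eqF.
rewrite lnK ?posrE ?divr_gt0// -invf_div => /le_trans; apply.
rewrite ler_wpM2l ?invr_ge0// big_seq [leRHS]big_seq; apply: ler_sum => t t_ts.
by apply: exp_proxy_ge => // i; exact: small.
Qed.

Lemma mean_dev_concentration eps : 0 <= S -> 0 < eps <= 1 ->
  eventually_whp P eps (fun n s => n%:R * sqnorm (mean_dev P zeta s) <= dev_bound eps).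
Proof.
rewrite le_eqVlt => /predU1P[S_eq0|S_gt0] eps01; last exact: mean_dev_concentration_gt0.
have trace_eq0 : expect P (fun z => sqnorm (zeta z)) = 0.
  apply/eqP; rewrite eq_le expect_sqnorm_ge0 andbT -sum_second_moment_delta//.
  apply: sumr_le0 => k _.
  by rewrite (le_trans (second_moment_le _))// -S_eq0 mul0r.
have zeta_eq0 := expect_sqnorm_eq0_ae zeta_L2 trace_eq0.
have mean_eq0 : mean_vec P zeta = 0.
  apply/rowP => j; rewrite !mxE -[RHS](expect_cst P); apply: ae_eq_expect => //.
    exact: Lfun_measurable (zeta_L2 j).
  by apply: filterS zeta_eq0 => z ->; rewrite mxE.
have [eps_gt0 _] := andP eps01; apply: eventually_whp_le (ltW eps_gt0) _.
apply: eventually_whp_impl (eventually_whp_forall_ae zeta_eq0) => n s s_eq0.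
rewrite /mean_dev mean_eq0 subr0 big1 => [|i _]; last exact: s_eq0.
by rewrite scaler0 /sqnorm dot0v mulr0 /dev_bound trace_eq0 -S_eq0 !mulr0 mul0r addr0.
Qed.

End mean_concentration.

Lemma mean_dev_weak_law (R : realType) (dT : measure_display) (T : measurableType dT)
    (P : probability T R) (d : nat) (zeta : T -> 'rV[R]_d) (eps delta : R) :
  square_integrable P zeta -> 0 < eps <= 1 -> 0 < delta ->
  eventually_whp P eps (fun n s => sqnorm (mean_dev P zeta s) <= delta).
Proof.
move=> zeta_L2 eps01 delta_gt0.
have conc := mean_dev_concentration zeta_L2 (second_moment_le_trace zeta_L2)
  (expect_sqnorm_ge0 P zeta) eps01.
rewrite -[eps]addr0; set C := dev_bound _ _ _ _ in conc.
apply: eventually_whp_impl (eventually_whp_and conc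
  (eventually_whp_size_ge P (Num.bound (`|C| / delta)).+1)) => n s [dev_le n_large].
have n_gt0 : 0 < n%:R :> R by rewrite ltr0n (leq_trans _ n_large).
rewrite -(ler_pM2l n_gt0) (le_trans dev_le)// (le_trans (ler_norm _))//.
rewrite -ler_pdivrMr// (le_trans (ltW (archi_boundP _))) ?divr_ge0 ?(ltW delta_gt0)//.
by rewrite ler_nat ltnW.
Qed.

(** * Ridge regression *)

Section quadratic_objectives.
Context {R : realType} {d : nat} {dX : measure_display} {X : measurableType dX}.
Variables (P : probability (X * R)%type R) (phi : X -> 'rV[R]_d) (lam : R).
Variable theta_t : 'rV[R]_d.
Implicit Types u v : 'rV[R]_d.

Definition resid (z : X * R) : R := f_lin phi theta_t z.1 - z.2.

Definition pop_slope u : R :=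
  expect P (fun z => resid z * dotv u (phi z.1)) + lam * dotv theta_t u.

Definition pop_ridge_form u : R :=
  expect P (fun z => dotv u (phi z.1) ^+ 2) + lam * sqnorm u.

Definition emp_slope n (s : 'I_n -> X * R) u : R :=
  n%:R^-1 * (\sum_i resid (s i) * dotv u (phi (s i).1)) + lam * dotv theta_t u.

Definition emp_ridge_form n (s : 'I_n -> X * R) u : R :=
  n%:R^-1 * (\sum_i dotv u (phi (s i).1) ^+ 2) + lam * sqnorm u.

Definition emp_argmin (Theta : set 'rV[R]_d) n (s : 'I_n -> X * R) : set 'rV[R]_d :=
  [set theta | Theta theta /\
    forall theta', Theta theta' -> emp_obj s phi lam theta <= emp_obj s phi lam theta'].

Lemma residE z : resid z ^+ 2 = (z.2 - f_lin phi theta_t z.1) ^+ 2.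
Proof. by rewrite -sqrrN opprB. Qed.

Lemma emp_objD n (s : 'I_n -> X * R) u : emp_obj s phi lam (theta_t + u) =
  emp_obj s phi lam theta_t + 2 * emp_slope s u + emp_ridge_form s u.
Proof.
rewrite /emp_obj (eq_bigr (fun i => (resid (s i) ^+ 2 +
    2 * (resid (s i) * dotv u (phi (s i).1))) + dotv u (phi (s i).1) ^+ 2)).
  by rewrite !big_split/= -mulr_sumr sqnormD /emp_slope /emp_ridge_form /resid; ring.
by move=> i _; rewrite /resid /f_lin dotvDl; ring.
Qed.

Lemma emp_slopeZ n (s : 'I_n -> X * R) c u : emp_slope s (c *: u) = c * emp_slope s u.
Proof.
rewrite /emp_slope dotvZr; under eq_bigr do rewrite dotvZl mulrCA.
by rewrite -mulr_sumr; ring.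
Qed.

Lemma emp_ridge_formZ n (s : 'I_n -> X * R) c u :
  emp_ridge_form s (c *: u) = c ^+ 2 * emp_ridge_form s u.
Proof.
rewrite /emp_ridge_form sqnormZ; under eq_bigr do rewrite dotvZl exprMn.
by rewrite -mulr_sumr; ring.
Qed.

Lemma emp_argmin_slope_le (Theta : set 'rV[R]_d) n (s : 'I_n -> X * R) u :
  0 <= lam -> convex_set Theta -> Theta theta_t -> emp_argmin Theta s (theta_t + u) ->
  emp_slope s u + emp_ridge_form s u <= 0.
Proof.
move=> lam_ge0 cvx Theta_t [inTheta_u min_u].
have form_ge0 : 0 <= emp_ridge_form s u.
  rewrite addr_ge0 ?mulr_ge0 ?sqnorm_ge0 ?invr_ge0// sumr_ge0// => i _.
  exact: sqr_ge0.
suff : 2 * emp_slope s u + 2 * emp_ridge_form s u <= 0 by lra.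
apply: quadratic_min_slope_le0 => // t /andP[t_gt0 t_lt1].
have Theta_tu : Theta (theta_t + t *: u).
  have := cvx (theta_t + u) theta_t (Itv01 (ltW t_gt0) (ltW t_lt1)).
  rewrite !inE => /(_ inTheta_u Theta_t).
  have -> // : theta_t + t *: u = t *: (theta_t + u) + (1 - t) *: theta_t.
  by rewrite scalerDr scalerBl scale1r [RHS]addrC addrA subrK.
by have := min_u _ Theta_tu; rewrite !emp_objD emp_slopeZ emp_ridge_formZ; lra.
Qed.

Hypothesis phi_L2 : square_integrable P (phi \o fst).
Hypothesis Y_L2 : (fun z : X * R => z.2) \in Lfun P 2%:E.

Lemma Lfun2_resid : resid \in Lfun P 2%:E.
Proof. by apply: rpredB => //; exact: Lfun2_dotv phi_L2 theta_t. Qed.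

Lemma pop_objD u : pop_obj P phi lam (theta_t + u) =
  pop_obj P phi lam theta_t + 2 * pop_slope u + pop_ridge_form u.
Proof.
have resid_L2 := Lfun2_resid; have /Lfun2_sqrP[_ resid_sqr_L1] := resid_L2.
have dot_sqr_L1 := Lfun1_sqr_dotv phi_L2 u.
have resid_dot_L1 : (fun z => resid z * dotv u (phi z.1)) \in Lfun P 1.
  exact: Lfun2_mul_Lfun1 resid_L2 (Lfun2_dotv phi_L2 u).
rewrite /pop_obj -(eq_expect P residE) (eq_expect _ (g := fun z =>
  (resid z ^+ 2 + 2 * (resid z * dotv u (phi z.1))) + dotv u (phi z.1) ^+ 2)).
  by rewrite !expectD ?rpredD ?rpredZ// expectZ// sqnormD /pop_slope /pop_ridge_form; ring.
by move=> z; rewrite /resid /f_lin dotvDl; ring.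
Qed.

Lemma expect_dotvM u v :
  expect P (fun z => dotv u (phi z.1) * dotv v (phi z.1)) = dotv (u *m Qmat P phi) v.
Proof.
have phiM_L1 i j : (fun z => phi z.1 0 i * phi z.1 0 j) \in Lfun P 1.
  exact: Lfun2_mul_Lfun1.
transitivity (\sum_j \sum_i v 0 j * u 0 i * expect P (fun z => phi z.1 0 i * phi z.1 0 j)).
  rewrite (eq_expect _ (g := fun z =>
      \sum_j \sum_i v 0 j * u 0 i * (phi z.1 0 i * phi z.1 0 j))).
    rewrite expect_sum => [|j]; last by apply: Lfun_sum => // i; exact: rpredZ.
    apply: eq_bigr => j _; rewrite expect_sum => [|i]; last exact: rpredZ.
    by apply: eq_bigr => i _; rewrite expectZ.
  move=> z; rewrite mulrC /dotv mulr_suml; apply: eq_bigr => j _.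
  by rewrite mulr_sumr; apply: eq_bigr => i _; ring.
apply: eq_bigr => j _; rewrite mxE mulr_suml; apply: eq_bigr => i _.
by rewrite mxE; ring.
Qed.

Lemma expect_sqnorm_mulmx e (M : 'M[R]_(d, e)) :
  expect P (fun z => sqnorm (phi z.1 *m M)) = \tr (M^T *m Qmat P phi *m M).
Proof.
have coordE z k : (phi z.1 *m M) 0 k = dotv (row k M^T) (phi z.1).
  by rewrite mxE; apply: eq_bigr => j _; rewrite !mxE mulrC.
rewrite expect_sum => [|k].
  apply: eq_bigr => k _; under eq_expect do rewrite coordE.
  by rewrite expect_dotvM -row_mul dotv_row trmxK.
under eq_fun do rewrite coordE.
by apply: Lfun2_mul_Lfun1; exact: Lfun2_dotv phi_L2 _.
Qed.

End quadratic_objectives.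

Section conditional_expectation.
Context {R : realType} {dX : measure_display} {X : measurableType dX}.
Variables (P : probability (X * R)%type R) (h : X * R -> R) (g : X -> \bar R).
Hypotheses (mh : measurable_fun setT h) (h_ge0 : forall z, 0 <= h z).
Hypotheses (gP : cond_exp_X P h g) (g_ge0 : forall x, (0 <= g x)%E).
Local Notation sup_g := (ess_sup P (fun z => g z.1)).

Lemma ess_sup_cond_exp_ge0 : (0 <= sup_g)%E.
Proof.
apply: ess_sup_gee; last by apply: aeW => z; exact: g_ge0.
by rewrite [X in (_ < X)%E]probability_setT.
Qed.

Lemma expect_cond_exp_le (k : X -> R) : sup_g \is a fin_num ->
  measurable_fun setT k -> (forall x, 0 <= k x) ->
  (fun z => k z.1 * h z) \in Lfun P 1 -> (fun z => k z.1) \in Lfun P 1 ->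
  expect P (fun z => k z.1 * h z) <= fine sup_g * expect P (fun z => k z.1).
Proof.
move=> sup_fin mk k_ge0 kh_L1 k_L1; have [mg gE] := gP.
have mgfst : measurable_fun setT (fun z : X * R => g z.1).
  exact: measurableT_comp mg measurable_fst.
have mkfst : measurable_fun setT (fun z : X * R => (k z.1)%:E).
  by apply/measurable_EFinP; exact: Lfun_measurable k_L1.
rewrite -expectZ// -lee_fin -!expectE ?rpredZ//.
rewrite [leLHS](_ : _ = \int[P]_z (g z.1 * (k z.1)%:E))%E; last first.
  under eq_integral do rewrite mulrC EFinM.
  apply: (ge0_integralM_comp_eq (Z1 := fst) (Z2 := fst)) => // [|A mA].
    exact/measurable_EFinP.
  rewrite (_ : fst @^-1` A = A `*` [set: R]); first by rewrite gE.
  by apply/seteqP; split => z //= [].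
apply: ae_ge0_le_integral => //.
- by move=> z _; rewrite mule_ge0 ?lee_fin.
- exact: emeasurable_funM.
- by move=> z _; rewrite lee_fin mulr_ge0// fine_ge0 ?ess_sup_cond_exp_ge0.
- by under eq_fun do rewrite EFinM; exact: emeasurable_funM.
- apply: filterS (ess_sup_ge P (fun z => g z.1)) => z gz _.
  by rewrite EFinM fineK// lee_wpmul2r// lee_fin.
Qed.

End conditional_expectation.

Section ridge_regression.
Context {R : realType} {d : nat} {dX : measure_display} {X : measurableType dX}.
Variables (P : probability (X * R)%type R) (phi : X -> 'rV[R]_d) (lam : R).
Variables (theta_t : 'rV[R]_d) (U : 'M[R]_d) (nu : 'rV[R]_d).
Hypothesis phi_L2 : square_integrable P (phi \o fst).
Hypothesis lam_ge0 : 0 <= lam.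
Hypothesis specQ : spectral_decomp (Qmat P phi) U nu.
Implicit Types u v t : 'rV[R]_d.

Local Notation resid := (resid phi theta_t).
Local Notation ridge_form := (pop_ridge_form P phi lam).
Local Notation Ql := (Qlam_isqrt U nu lam).
Local Notation D := (ridge_dim nu lam).

Definition Qlam_sqrt : 'M[R]_d := spectral_fun U nu (fun x => Num.sqrt (x + lam)).

(* Zero unless [lam = 0] and [Q] is singular. *)
Definition Qlam_null_proj : 'M[R]_d := spectral_fun U nu (fun x => (x + lam == 0)%:R).

Definition whitened (z : X * R) : 'rV[R]_d := phi z.1 *m Ql.

Definition score (z : X * R) : 'rV[R]_d := resid z *: whitened z.

Definition resid_form v : R := expect P (fun z => dotv v (phi z.1) ^+ 2 * resid z ^+ 2).

(* By [x / 0 = 0], directions in which [ridge_form] vanishes do not contribute. *)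
Definition resid_ratio_sup : \bar R :=
  ereal_sup [set (resid_form v / ridge_form v)%:E | v in [set: 'rV[R]_d]].

Local Notation score_trace := (expect P (fun z => sqnorm (score z))).
Local Notation whitened_sqr := (fun z => outer_sqr (whitened z)).

Let UU : U *m U^T = 1%:M. Proof. by case: specQ. Qed.

Lemma Qlam_isqrtE : Ql = spectral_fun U nu (fun x => (Num.sqrt (x + lam))^-1).
Proof. by []. Qed.

Lemma QmatE : Qmat P phi = spectral_fun U nu id.
Proof.
have [_ [-> _]] := specQ.
by congr (_ *m diag_mx _ *m _); apply/rowP => k; rewrite mxE.
Qed.

Lemma eigenvalue_ge0 k : 0 <= nu 0 k.
Proof.
have -> : nu 0 k = dotv (row k U *m Qmat P phi) (row k U).
  by rewrite -row_mul dotv_row QmatE !mulmxA UU mul1mx -mulmxA UU mulmx1 !mxE eqxx.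
by rewrite -expect_dotvM//; apply: expect_ge0 => z; rewrite -expr2 sqr_ge0.
Qed.

Lemma eigenvalueD_ge0 k : 0 <= nu 0 k + lam.
Proof. by rewrite addr_ge0// eigenvalue_ge0. Qed.

Lemma ridge_formE u : ridge_form u = sqnorm (u *m Qlam_sqrt).
Proof.
rewrite sqnorm_mul_spectral_fun//.
rewrite (@eq_spectral_fun _ _ _ _ _ (fun x => x + lam)); last first.
  by move=> k; rewrite sqr_sqrtr ?eigenvalueD_ge0.
rewrite -(spectral_funD _ _ id) spectral_fun_cst// -QmatE mulmxDr mul_mx_scalar.
by rewrite dotvDl dotvZl -expect_dotvM.
Qed.

Lemma ridge_form_ge0 v : 0 <= ridge_form v.
Proof. by rewrite ridge_formE sqnorm_ge0. Qed.

Lemma ridge_form_isqrt_le t : ridge_form (t *m Ql) <= sqnorm t.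
Proof.
rewrite ridge_formE -mulmxA Qlam_isqrtE spectral_funM//.
apply: sqnorm_mul_spectral_fun_le => // k; rewrite mulrC.
have [->|sqrt_neq0] := eqVneq (Num.sqrt (nu 0 k + lam)) 0; first by rewrite mul0r expr0n.
by rewrite divff// expr1n.
Qed.

Lemma Qlam_sqrt_isqrt : Qlam_sqrt *m Ql = 1%:M - Qlam_null_proj.
Proof.
apply: (addIr Qlam_null_proj); rewrite subrK.
rewrite Qlam_isqrtE spectral_funM// spectral_funD -(@spectral_fun_cst _ _ U nu UU).
apply: eq_spectral_fun => k; have [->|nulam_neq0] := eqVneq (nu 0 k + lam) 0.
  by rewrite sqrtr0 mul0r add0r.
by rewrite divff ?addr0// sqrtr_eq0 -ltNge lt_neqAle eq_sym nulam_neq0 eigenvalueD_ge0.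
Qed.

Lemma expect_sqnorm_whitened : expect P (fun z => sqnorm (whitened z)) = D.
Proof.
rewrite expect_sqnorm_mulmx// QmatE Qlam_isqrtE tr_spectral_fun !spectral_funM//.
rewrite mxtrace_spectral_fun//; apply: eq_bigr => k _.
rewrite mulrAC -invfM -expr2 sqr_sqrtr ?eigenvalueD_ge0//.
have := eigenvalue_ge0 k; rewrite le_eqVlt => /predU1P[<-|nu_gt0].
  by rewrite ltxx mulr0.
by rewrite nu_gt0 mulrC.
Qed.

Lemma ridge_dim_ge0 : 0 <= D.
Proof. by rewrite -expect_sqnorm_whitened expect_sqnorm_ge0. Qed.

Lemma square_integrable_whitened : square_integrable P whitened.
Proof. exact: square_integrable_mulmx. Qed.

Lemma ae_phi_null : \forall z \ae P, phi z.1 *m Qlam_null_proj = 0.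
Proof.
have trace_eq0 : expect P (fun z => sqnorm (phi z.1 *m Qlam_null_proj)) = 0.
  rewrite expect_sqnorm_mulmx// QmatE tr_spectral_fun !spectral_funM//.
  rewrite mxtrace_spectral_fun// big1// => k _.
  have [nulam_eq0|] := eqVneq (nu 0 k + lam) 0; last by rewrite !mul0r.
  suff -> : nu 0 k = 0 by rewrite mulr0 mul0r.
  by apply: le_anti; rewrite eigenvalue_ge0 andbT -nulam_eq0 lerDl.
by apply: expect_sqnorm_eq0_ae trace_eq0; exact: square_integrable_mulmx.
Qed.

Lemma dotv_whitened z u : phi z.1 *m Qlam_null_proj = 0 ->
  dotv u (phi z.1) = dotv (u *m Qlam_sqrt) (whitened z).
Proof.
move=> phi_null; rewrite dotv_mulmxr Qlam_isqrtE tr_spectral_fun -Qlam_isqrtE.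
rewrite -mulmxA Qlam_sqrt_isqrt mulmxBr mulmx1 dotvC [RHS]dotvC dotvBr.
rewrite [dotv _ (u *m _)]dotv_mulmxr tr_spectral_fun -/Qlam_null_proj phi_null.
by rewrite dot0v subr0.
Qed.

Hypothesis Y_L2 : (fun z : X * R => z.2) \in Lfun P 2%:E.
Hypothesis phi_resid_L1 : (fun z => sqnorm (phi z.1) * resid z ^+ 2) \in Lfun P 1.

Lemma measurable_resid : measurable_fun setT resid.
Proof. exact: Lfun_measurable (Lfun2_resid theta_t phi_L2 Y_L2). Qed.

Lemma square_integrable_resid_phi : square_integrable P (fun z => resid z *: phi z.1).
Proof.
apply: square_integrable_scale measurable_resid _ phi_resid_L1 => j.
exact: Lfun_measurable (phi_L2 j).
Qed.

Lemma square_integrable_score : square_integrable P score.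
Proof.
rewrite (_ : score = fun z => (resid z *: phi z.1) *m Ql).
  exact: square_integrable_mulmx square_integrable_resid_phi.
by apply/funext => z; rewrite -scalemxAl.
Qed.

Lemma Lfun1_resid_form v : (fun z => dotv v (phi z.1) ^+ 2 * resid z ^+ 2) \in Lfun P 1.
Proof.
under eq_fun do rewrite mulrC -exprMn -dotvZr.
exact: Lfun1_sqr_dotv square_integrable_resid_phi v.
Qed.

Lemma expect_sqnorm_score :
  score_trace = expect P (fun z => sqnorm (whitened z) * resid z ^+ 2).
Proof. by apply: eq_expect => z; rewrite sqnormZ mulrC. Qed.

Lemma second_moment_score t : second_moment P score t = resid_form (t *m Ql).
Proof.
apply: eq_expect => z; rewrite dotvZr dotv_mulmxr Qlam_isqrtE tr_spectral_fun.
by rewrite exprMn mulrC.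
Qed.

Lemma resid_formE v : resid_form v = second_moment P score (v *m Qlam_sqrt).
Proof.
apply: ae_eq_expect.
- exact: Lfun_measurable (Lfun1_resid_form v).
- exact: Lfun_measurable (Lfun1_sqr_dotv square_integrable_score _).
by apply: filterS ae_phi_null => z /dotv_whitened ->; rewrite dotvZr exprMn mulrC.
Qed.

Lemma resid_form_le_trace v : resid_form v <= score_trace * ridge_form v.
Proof.
rewrite resid_formE ridge_formE; exact: second_moment_le_trace square_integrable_score _.
Qed.

Lemma resid_ratio_sup_ge0 : (0 <= resid_ratio_sup)%E.
Proof.
apply: le_trans (ereal_sup_ubound (ex_intro2 _ _ 0 I erefl)).
rewrite lee_fin divr_ge0 ?ridge_form_ge0// expect_ge0// => z.
by rewrite mulr_ge0 ?sqr_ge0.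
Qed.

Lemma resid_ratio_sup_le c : 0 <= c -> (forall v, resid_form v <= c * ridge_form v) ->
  (resid_ratio_sup <= c%:E)%E.
Proof.
move=> c_ge0 form_le; apply: ge_ereal_sup => _ [v _ <-]; rewrite lee_fin.
by apply: ge0_ler_pdivrMr => //; exact: ridge_form_ge0.
Qed.

Lemma resid_ratio_sup_fin_num : resid_ratio_sup \is a fin_num.
Proof.
rewrite ge0_fin_numE ?resid_ratio_sup_ge0//; apply: le_lt_trans (ltry _).
by apply: resid_ratio_sup_le resid_form_le_trace; exact: expect_sqnorm_ge0.
Qed.

Lemma resid_form_le v : resid_form v <= fine resid_ratio_sup * ridge_form v.
Proof.
have := ridge_form_ge0 v; rewrite le_eqVlt => /predU1P[form_eq0|form_gt0].
  by have := resid_form_le_trace v; rewrite -form_eq0 !mulr0.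
rewrite -ler_pdivrMr// -lee_fin fineK ?resid_ratio_sup_fin_num//.
by apply: ereal_sup_ubound; exists v.
Qed.

Lemma second_moment_score_le t :
  second_moment P score t <= fine resid_ratio_sup * sqnorm t.
Proof.
rewrite second_moment_score (le_trans (resid_form_le _))//.
by rewrite ler_wpM2l ?ridge_form_isqrt_le// fine_ge0 ?resid_ratio_sup_ge0.
Qed.

Hypothesis phi_fourth_L1 : (fun z => sqnorm (phi z.1) ^+ 2) \in Lfun P 1.

Lemma square_integrable_whitened_sqr : square_integrable P whitened_sqr.
Proof.
under [X in square_integrable _ X]eq_fun do rewrite /whitened outer_sqr_mulmx.
apply: square_integrable_mulmx; apply: square_integrable_outer_sqr => // j.
exact: Lfun_measurable (phi_L2 j).
Qed.

Section fixed_sample.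
Variables (n : nat) (s : 'I_n -> X * R).
Hypothesis s_null : forall i, phi (s i).1 *m Qlam_null_proj = 0.

Lemma emp_slopeE u : emp_slope phi lam theta_t s u =
  pop_slope P phi lam theta_t u + dotv (u *m Qlam_sqrt) (mean_dev P score s).
Proof.
rewrite (dotv_mean_dev square_integrable_score) /emp_slope /pop_slope.
have -> : expect P (fun z => resid z * dotv u (phi z.1)) =
    expect P (fun z => dotv (u *m Qlam_sqrt) (score z)).
  apply: ae_eq_expect.
  - apply: measurable_funM; first exact: measurable_resid.
    exact: Lfun_measurable (Lfun2_dotv phi_L2 u).
  - exact: Lfun_measurable (Lfun2_dotv square_integrable_score _).
  by apply: filterS ae_phi_null => z /dotv_whitened ->; rewrite dotvZr.
rewrite addrAC subrKC; congr (_ * _ + _); apply: eq_bigr => i _.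
by rewrite dotv_whitened// dotvZr.
Qed.

Lemma emp_ridge_formE u : emp_ridge_form phi lam s u =
  ridge_form u + dotv (outer_sqr (u *m Qlam_sqrt)) (mean_dev P whitened_sqr s).
Proof.
rewrite (dotv_mean_dev square_integrable_whitened_sqr) /emp_ridge_form /pop_ridge_form.
have -> : expect P (fun z => dotv u (phi z.1) ^+ 2) =
    expect P (fun z => dotv (outer_sqr (u *m Qlam_sqrt)) (whitened_sqr z)).
  apply: ae_eq_expect.
  - exact: Lfun_measurable (Lfun1_sqr_dotv phi_L2 u).
  - exact: Lfun_measurable (Lfun2_dotv square_integrable_whitened_sqr _).
  by apply: filterS ae_phi_null => z /dotv_whitened ->; rewrite dotv_outer_sqr.
rewrite addrAC subrKC; congr (_ * _ + _); apply: eq_bigr => i _.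
by rewrite dotv_whitened// dotv_outer_sqr.
Qed.

Lemma excess_risk_le (Theta : set 'rV[R]_d) theta_h :
  convex_set Theta -> Theta theta_t -> emp_argmin phi lam Theta s theta_h ->
  sqnorm (mean_dev P whitened_sqr s) <= 16^-1 ->
  pop_obj P phi lam theta_h <=
    pop_obj P phi lam theta_t + 2 * sqnorm (mean_dev P score s).
Proof.
move=> cvx Theta_t; rewrite -[theta_h](subrKC theta_t); set u := theta_h - theta_t.
move=> argmin_u cov_dev; rewrite pop_objD// -addrA lerD2l.
have := emp_argmin_slope_le lam_ge0 cvx Theta_t argmin_u.
rewrite emp_slopeE emp_ridge_formE ridge_formE.
set b := u *m Qlam_sqrt; set dev := mean_dev P score s; set cov := dotv (outer_sqr b) _.
have cov_ge : - (sqnorm b / 4) <= cov.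
  have b4_ge0 : 0 <= sqnorm b / 4 by rewrite divr_ge0 ?sqnorm_ge0.
  suff : `|cov| <= sqnorm b / 4 by rewrite ler_norml => /andP[].
  rewrite -(ler_pXn2r (_ : 0 < 2)%N) ?nnegrE// real_normK ?num_real//.
  apply: le_trans (sqr_dotv_le _ _) _; rewrite sqnorm_outer_sqr exprMn.
  by rewrite ler_wpM2l ?sqr_ge0// (le_trans cov_dev)//; lra.
by have := sqnorm_ge0 (b + 2 *: dev); rewrite sqnormD sqnormZ dotvZr; lra.
Qed.

End fixed_sample.

Lemma excess_risk_whp (Theta : set 'rV[R]_d) (eps : R) :
  convex_set Theta -> Theta theta_t -> 0 < eps <= 1 ->
  eventually_whp P eps (fun n s => forall theta_h, emp_argmin phi lam Theta s theta_h ->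
    pop_obj P phi lam theta_h <= pop_obj P phi lam theta_t +
      30 * score_trace / n%:R + 1000 * fine resid_ratio_sup * (ln (3 * eps^-1) / n%:R)).
Proof.
move=> cvx Theta_t /[dup] eps01 /andP[eps_gt0 eps_le1].
have half01 : 0 < eps / 2 <= 1 by apply/andP; split; lra.
have ratio_ge0 : 0 <= fine resid_ratio_sup by rewrite fine_ge0 ?resid_ratio_sup_ge0.
have score_conc := mean_dev_concentration square_integrable_score second_moment_score_le
  ratio_ge0 half01.
have tol_gt0 : 0 < 16^-1 :> R by rewrite invr_gt0.
have cov_conc := mean_dev_weak_law square_integrable_whitened_sqr half01 tol_gt0.
rewrite [eps](_ : _ = eps / 2 + (eps / 2 + (0 + 0))); last by field.
apply: eventually_whp_impl (eventually_whp_and score_conc (eventually_whp_and cov_conc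
  (eventually_whp_and (eventually_whp_forall_ae ae_phi_null) (eventually_whp_size_ge P 1)))).
rewrite !addr0 -splitr => n s [score_dev [cov_dev [s_null n_gt0]]] theta_h argmin_h.
have nR_gt0 : 0 < n%:R :> R by rewrite ltr0n.
apply: le_trans (excess_risk_le s_null cvx Theta_t argmin_h cov_dev) _.
rewrite -[leRHS]addrA lerD2l mulrA -mulrDl ler_pdivlMr//.
rewrite /dev_bound in score_dev; have trace_ge0 := expect_sqnorm_ge0 P score.
set L := ln (3 * eps^-1); have L_ge0 : 0 <= L by rewrite ln_ge0// ler_pdivlMr//; lra.
have := mulr_ge0 ratio_ge0 L_ge0; have := ler_wpM2l ratio_ge0 (ln_confidence_le eps01).
by rewrite -/L; lra.
Qed.

(* Dividing by [D] is harmless even when it vanishes, as the score is then almost surely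
   zero. *)
Lemma score_trace_divK c : c * score_trace / D * D = c * score_trace.
Proof.
have [D_eq0|D_neq0] := eqVneq D 0; last by rewrite divfK.
suff -> : score_trace = 0 by rewrite mulr0 !mul0r.
rewrite -[RHS](expect_cst P); apply: ae_eq_expect => //.
  exact: Lfun_measurable (Lfun1_sqnorm square_integrable_score).
have := expect_sqnorm_eq0_ae square_integrable_whitened.
rewrite expect_sqnorm_whitened => /(_ D_eq0); apply: filterS => z whitened_eq0.
by rewrite /score whitened_eq0 scaler0 /sqnorm dot0v.
Qed.

Section conditional_variance.
Hypothesis mphi : forall j, measurable_fun setT (fun x => phi x 0 j).
Variable g : X -> \bar R.
Hypothesis gP : cond_exp_X P (fun z => resid z ^+ 2) g.
Hypothesis g_ge0 : forall x, (0 <= g x)%E.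
Local Notation sigma2 := (ess_sup P (fun z => g z.1)).

Let measurable_resid_sqr : measurable_fun setT (fun z => resid z ^+ 2).
Proof. by apply: measurable_funX; exact: measurable_resid. Qed.

Let resid_sqr_ge0 z : 0 <= resid z ^+ 2.
Proof. exact: sqr_ge0. Qed.

Let sigma2_ge0 : (0 <= sigma2)%E := ess_sup_cond_exp_ge0 P g_ge0.

Lemma score_trace_le : sigma2 \is a fin_num -> score_trace <= fine sigma2 * D.
Proof.
move=> sigma2_fin; rewrite expect_sqnorm_score -expect_sqnorm_whitened.
apply: (expect_cond_exp_le measurable_resid_sqr resid_sqr_ge0 gP g_ge0
  (k := fun x => sqnorm (phi x *m Ql))) => //.
- by apply: measurable_sqnorm => k; exact: measurable_mulmx.
- by move=> x; exact: sqnorm_ge0.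
- under eq_fun do rewrite mulrC -sqnormZ; exact: Lfun1_sqnorm square_integrable_score.
- exact: Lfun1_sqnorm square_integrable_whitened.
Qed.

Lemma resid_ratio_sup_le_cond : (resid_ratio_sup <= sigma2)%E.
Proof.
have [sigma2_fin|] := boolP (sigma2 \is a fin_num); last first.
  by rewrite ge0_fin_numE// ltey negbK => /eqP ->; rewrite leey.
rewrite -(fineK sigma2_fin); apply: resid_ratio_sup_le => [|v]; first exact: fine_ge0.
apply: (@le_trans _ _ (fine sigma2 * expect P (fun z => dotv v (phi z.1) ^+ 2))).
  apply: (expect_cond_exp_le measurable_resid_sqr resid_sqr_ge0 gP g_ge0
    (k := fun x => dotv v (phi x) ^+ 2)) => //.
  - by apply: measurable_funX; exact: measurable_dotv.
  - by move=> x; exact: sqr_ge0.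
  - exact: Lfun1_resid_form.
  - exact: Lfun1_sqr_dotv phi_L2 v.
by rewrite ler_wpM2l ?fine_ge0// lerDl mulr_ge0// sqnorm_ge0.
Qed.

Lemma risk_bound_le_cond (m L : R) n : 0 < L -> (0 < n)%N ->
  ((m + 30 * score_trace / D * D / n%:R)%:E + 1000%:E * resid_ratio_sup * (L / n%:R)%:E <=
   m%:E + sigma2 * ((30 * D + 1000 * L) / n%:R)%:E)%E.
Proof.
move=> L_gt0 n_gt0; have nR_gt0 : 0 < n%:R :> R by rewrite ltr0n.
have D_ge0 := ridge_dim_ge0.
have [sigma2_fin|] := boolP (sigma2 \is a fin_num); last first.
  rewrite ge0_fin_numE// ltey negbK => /eqP ->.
  have coef_gt0 : 0 < (30 * D + 1000 * L) / n%:R by apply: divr_gt0 _ nR_gt0; lra.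
  by rewrite gt0_mulye ?lte_fin// addey// leey.
have ratio_le := resid_ratio_sup_le_cond.
rewrite -(fineK sigma2_fin) -(fineK resid_ratio_sup_fin_num) lee_fin in ratio_le.
rewrite -(fineK sigma2_fin) -(fineK resid_ratio_sup_fin_num) -!EFinM -!EFinD lee_fin.
rewrite score_trace_divK -addrA lerD2l [_ * (L / _)]mulrA -mulrDl [leRHS]mulrA.
rewrite ler_pM2r ?invr_gt0//; have := score_trace_le sigma2_fin.
by have := ler_wpM2r (ltW L_gt0) ratio_le; lra.
Qed.

End conditional_variance.
End ridge_regression.

Lemma square_integrable_comp_fst (R : realType) (d : nat) (d1 d2 : measure_display)
    (T1 : measurableType d1) (T2 : measurableType d2) (P : probability (T1 * T2)%type R)
    (zeta : T1 -> 'rV[R]_d) :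
  (forall j, measurable_fun setT (fun x => zeta x 0 j)) ->
  (forall j, P.-integrable setT (fun z => (zeta z.1 0 j ^+ 2)%:E)) ->
  square_integrable P (zeta \o fst).
Proof.
move=> mzeta zeta_sqr j; apply/Lfun2_sqrP; split; last exact/Lfun1_integrable/zeta_sqr.
exact: measurableT_comp (mzeta j) measurable_fst.
Qed.

Theorem theorem2p1 (R : realType) (d : nat) (dX : measure_display)
  (X : measurableType dX) (P : probability (X * R)%type R)
  (phi : X -> 'rV[R]_d) (Theta : set 'rV[R]_d) (lam : R)
  (theta_t : 'rV[R]_d) (U : 'M[R]_d) (nu : 'rV[R]_d) (g : X -> \bar R) :
  (* Y is square integrable *)
  P.-integrable setT (fun z => (z.2 ^+ 2)%:E) ->
  (* phi_1, ..., phi_d are square integrable w.r.t. the law of X *)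
  (forall j, measurable_fun setT (fun x => phi x 0 j)) ->
  (forall j, P.-integrable setT (fun z => (phi z.1 0 j ^+ 2)%:E)) ->
  (* Theta closed convex, lambda >= 0 *)
  closed Theta -> convex_set Theta -> 0 <= lam ->
  (* theta_t (= tilde theta) minimizes R(f_theta) + lambda ||theta||^2 on Theta *)
  Theta theta_t ->
  (forall theta, Theta theta -> pop_obj P phi lam theta_t <= pop_obj P phi lam theta) ->
  (* moment assumptions *)
  P.-integrable setT (fun z => (sqnorm (phi z.1) ^+ 2)%:E) ->
  P.-integrable setT
    (fun z => (sqnorm (phi z.1) * (f_lin phi theta_t z.1 - z.2) ^+ 2)%:E) ->
  (* eigen-decomposition of Q = E[phi(X) phi(X)^T], nu_1 >= ... >= nu_d *)
  spectral_decomp (Qmat P phi) U nu ->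
  (* g is a (nonnegative) version of E[(Y - tilde f(X))^2 | X] *)
  cond_exp_X P (fun z => (z.2 - f_lin phi theta_t z.1) ^+ 2) g ->
  (forall x, (0 <= g x)%E) ->
  let Ql := Qlam_isqrt U nu lam in
  let D := ridge_dim nu lam in
  let minval := inf [set pop_obj P phi lam theta | theta in Theta] in
  let A := expect P
    (fun z => sqnorm (phi z.1 *m Ql) * (f_lin phi theta_t z.1 - z.2) ^+ 2) in
  let B := expect P (fun z => sqnorm (phi z.1 *m Ql)) in
  let S := ereal_sup [set ((expect P (fun z => dotv v (phi z.1) ^+ 2
                                       * (f_lin phi theta_t z.1 - z.2) ^+ 2))
                            / (expect P (fun z => dotv v (phi z.1) ^+ 2)
                               + lam * sqnorm v))%:E | v in [set: 'rV[R]_d]] in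
  let sigma2 := ess_sup P (fun z => g z.1) in
  forall eps : R, 0 < eps ->
  exists n_eps : nat, forall n : nat, (2 <= n)%N -> (n_eps <= n)%N ->
  forall (dO : measure_display) (O : measurableType dO) (Pr : probability O R)
         (Z : 'I_n -> O -> (X * R)%type),
  iid_sample P Pr Z ->
  forall theta_h : O -> 'rV[R]_d,
  (forall w, Theta (theta_h w) /\
     forall theta, Theta theta ->
       emp_obj (fun i => Z i w) phi lam (theta_h w)
       <= emp_obj (fun i => Z i w) phi lam theta) ->
  exists E : set O, measurable E /\ ((1 - eps)%:E <= Pr E)%E /\
  forall w, E w ->
    ((pop_obj P phi lam (theta_h w))%:E
       <= (minval + 30 * A / B * D / n%:R)%:E
          + 1000%:E * S * (ln (3 * eps^-1) / n%:R)%:E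
     /\ (minval + 30 * A / B * D / n%:R)%:E
          + 1000%:E * S * (ln (3 * eps^-1) / n%:R)%:E
        <= minval%:E
          + sigma2 * ((30 * D + 1000 * ln (3 * eps^-1)) / n%:R)%:E)%E.
Proof.
move=> Y_sqr mphi phi_sqr _ cvx lam_ge0 Theta_t min_t phi_fourth phi_resid specQ gP g_ge0.
move=> Ql D minval A B S sigma2 eps eps_gt0.
have [eps_ge1|/ltW eps_le1] := leP 1 eps.
  by exists 0%N => *; exists set0; split; rewrite // measure0 lee_fin subr_le0.
have phi_L2 := square_integrable_comp_fst mphi phi_sqr.
have Y_L2 : (fun z : X * R => z.2) \in Lfun P 2%:E.
  by apply/Lfun2_sqrP; split; [exact: measurable_snd|exact/Lfun1_integrable].
move/Lfun1_integrable in phi_fourth; move/Lfun1_integrable in phi_resid.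
rewrite -(funext (residE phi theta_t)) in gP.
have -> : minval = pop_obj P phi lam theta_t := inf_image_min Theta_t min_t.
have -> : B = D := expect_sqnorm_whitened phi_L2 lam_ge0 specQ.
have -> : A = _ := esym (expect_sqnorm_score P phi lam theta_t U nu).
have S_fin : S \is a fin_num := resid_ratio_sup_fin_num phi_L2 lam_ge0 specQ Y_L2 phi_resid.
have [N risk_whp] := excess_risk_whp phi_L2 lam_ge0 specQ Y_L2 phi_resid phi_fourth cvx
  Theta_t (introT andP (conj eps_gt0 eps_le1)).
exists N => n n_ge2 Nn dO O Pr Z iidZ theta_h argmin_h.
have [Bad [mBad PBad risk_good]] := risk_whp n Nn _ _ Pr Z iidZ.
exists (~` Bad); split; first exact: measurableC.
split=> [|w /risk_good risk_w]; first by rewrite probability_setC// EFinB leeB.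
split; last first.
  apply: risk_bound_le_cond gP _ _ _ _ _ (ltnW n_ge2) => //.
  by rewrite ln_gt0// ltr_pdivlMr//; lra.
rewrite -(fineK S_fin) -!EFinM -!EFinD lee_fin score_trace_divK//.
exact: risk_w (argmin_h w).
Qed.
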